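(* Let $K$ be a field, let $L$ be a numerical semigroup minimally generated by $a_1<\dots<a_n$, and let $c>1$ and $d$ be coprime integers with $d\in L\setminus\{a_1,\dots,a_n\}$. Let $H=\langle cL,d\rangle=\langle ca_1,\dots,ca_n,d\rangle$. Then the following hold: (i) $\beta_i(K[H])=\beta_i(K[L])+\beta_{i-1}(K[L])$ for all $i>0$. (ii) If $c\le \mathrm{ord}_L(d)$, then $\beta_i(\mathrm{gr}_{\mathfrak{m}}K[H])=\beta_i(\mathrm{gr}_{\mathfrak{m}}K[L])+\beta_{i-1}(\mathrm{gr}_{\mathfrak{m}}K[L])$ for all $i>0$.
   Context: A numerical semigroup $H$ is a subset of $\mathbb{N}=\{0,1,2,\dots\}$ that contains $0$, is closed under addition, and has $|\mathbb{N}\setminus H|<\infty$. It has a unique minimal generating set. $\langle b_1,\dots,b_m\rangle$ denotes the submonoid of $\mathbb{N}$ generated by $b_1,\dots,b_m$. In the situation of the theorem, $H$ is a numerical semigroup minimally generated by $ca_1,\dots,ca_n,d$. For a numerical semigroup $H$ minimally generated by $b_1,\dots,b_m$, the semigroup ring $K[H]$ is the $K$-subalgebra of $K[t]$ generated by the monomials $t^h$, $h\in H$. Let $S_H=K[x_1,\dots,x_m]$ and let $I_H$ be the kernel of the $K$-algebra map $S_H\to K[H]$, $x_i\mapsto t^{b_i}$, so $K[H]\cong S_H/I_H$; this is graded with respect to $\deg x_i=b_i$. The tangent cone is the associated graded ring $\mathrm{gr}_{\mathfrak{m}}K[H]=\bigoplus_{i\ge 0}\mathfrak{m}^i/\mathfrak{m}^{i+1}$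 with respect to the maximal ideal $\mathfrak{m}=(t^h : h\in H\setminus\{0\})K[H]$ (for each semigroup, $\mathfrak m$ denotes the corresponding ideal). It is isomorphic to $S_H/I_H^*$, where $I_H^*=(f^*: 0\ne f\in I_H)$ and $f^*$ is the homogeneous component of smallest degree of $f$ with respect to the standard grading of $S_H$. The Betti numbers are $\beta_i(K[H])=\dim_K\mathrm{Tor}_i^{S_H}(K[H],K)$ and $\beta_i(\mathrm{gr}_{\mathfrak{m}}K[H])=\dim_K\mathrm{Tor}_i^{S_H}(S_H/I_H^*,K)$, where $K=S_H/(x_1,\dots,x_m)$; i.e. they are the ranks of the free modules in the minimal graded free resolution over $S_H$. For $H$ as in the theorem the polynomial ring has $n+1$ variables, while for $L$ it has $n$ variables. The order of $d$ in $L$ is $\mathrm{ord}_L(d)=\max\{\sum_{i=1}^n\lambda_i : d=\sum_{i=1}^n\lambda_i a_i,\ \lambda_i\in\mathbb{N}\}$. *)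

(* Defs.v *)
From HB Require Import structures.
From mathcomp Require Import all_boot all_order all_algebra.
From mathcomp Require Import generic_quotient ring_quotient.
From mathcomp Require Import boolp classical_sets cardinality.
From mathcomp Require Import mpoly.

Set Implicit Arguments.
Unset Strict Implicit.
Unset Printing Implicit Defensive.

Import GRing.Theory.
Local Open Scope ring_scope.
Local Open Scope classical_set_scope.
Local Open Scope quotient_scope.

Definition numerical_semigroup (H : set nat) : Prop :=
  [/\ H 0%N, (forall x y, H x -> H y -> H (x + y)%N) & finite_set (~` H)].

Definition submonoid_on (m : nat) (b : 'I_m -> nat) (J : {set 'I_m}) : set nat :=
  [set h | exists l : 'I_m -> nat, h = (\sum_(i in J) l i * b i)%N].

Definition submonoid (m : nat) (b : 'I_m -> nat) : set nat :=
  submonoid_on b [set: 'I_m]%SET.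

Definition minimally_generates (m : nat) (b : 'I_m -> nat) (H : set nat) : Prop :=
  H = submonoid b /\
  forall J : {set 'I_m}, H = submonoid_on b J -> J = [set: 'I_m]%SET.

(* For positive [a i], every l with \sum_i l i * a i = d satisfies l i <= d, so
   letting the coefficients range over 'I_d.+1 loses nothing. *)
Definition sgp_ord (n : nat) (a : 'I_n -> nat) (d : nat) : nat :=
  (\max_(l : {ffun 'I_n -> 'I_d.+1} | \sum_i l i * a i == d) \sum_i l i)%N.

(* The tuple (c a_1, ..., c a_n, d). *)
Definition gluing (n : nat) (a : 'I_n -> nat) (c d : nat) : 'I_n.+1 -> nat :=
  fun i => if unlift ord_max i is Some j then (c * a j)%N else d.

Section Tor.
Variables (K : fieldType) (m : nat).
Local Notation S := {mpoly K[m]}.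

(* Resolutions by free modules of finite rank; vectors are rows and the maps
   act on the right: ... -> S^(rk 2) -> S^(rk 1) -> S^(rk 0) -> M -> 0. *)
Record free_resolution (M : lmodType S) := FreeResolution {
  rk : nat -> nat;
  aug : {linear 'rV[S]_(rk 0) -> M};
  diff : forall i, 'M[S]_(rk i.+1, rk i);
  aug_surj : forall y : M, exists u, aug u = y;
  exact_aug : forall u, aug u = 0 <-> exists v, u = v *m diff 0%N;
  exact_diff : forall i (u : 'rV[S]_(rk i.+1)),
    u *m diff i = 0 <-> exists v, u = v *m diff i.+1
}.

(* The i-th differential of F \otimes_S K, where K = S / (x_1, ..., x_m): only
   the constant coefficients survive. *)
Definition diffK (M : lmodType S) (F : free_resolution M) (i : nat) :
    'M[K]_(rk F i.+1, rk F i) :=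
  map_mx (mcoeff 0%MM) (diff F i).

(* dim_K of H_i (F \otimes_S K) *)
Definition tor_dim (M : lmodType S) (F : free_resolution M) (i : nat) : nat :=
  match i with
  | 0 => (rk F 0 - \rank (diffK F 0))%N
  | j.+1 => (\rank (kermx (diffK F j)) - \rank (diffK F j.+1))%N
  end.

(* dim_K Tor_i^S(M, K).  It does not depend on the resolution, and one exists
   for every finitely generated M as S is noetherian; the value 0 is a dummy
   for the remaining M. *)
Definition betti (M : lmodType S) (i : nat) : nat :=
  xget 0%N [set b | exists F : free_resolution M, b = tor_dim F i].

End Tor.

(* S / (G) as an S-module, G an arbitrary set of elements. *)
Section IdealQuotient.
Variables (S : comNzRingType) (G : set S).

Definition ideal_span : {pred S} :=
  fun f => `[< exists r : seq (S * S),
    (forall p, p \in r -> G p.2) /\ f = \sum_(p <- r) p.1 * p.2 >].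

Lemma ideal_span_linear : linear_closed (ideal_span : {pred S^o}).
Proof.
move=> c f g /asboolP[r [Gr ->]] /asboolP[s [Gs ->]]; apply/asboolP.
exists ([seq (c * p.1, p.2) | p <- r] ++ s); split.
  by move=> p; rewrite mem_cat => /orP[/mapP[q /Gr Gq ->]|/Gs].
rewrite big_cat big_map /= /GRing.scale /= mulr_sumr; congr (_ + _).
by apply: eq_bigr => p _; rewrite mulrA.
Qed.

Lemma ideal_span0 : 0 \in ideal_span.
Proof. by apply/asboolP; exists [::]; rewrite big_nil. Qed.

Lemma ideal_span_zmod : zmod_closed ideal_span.
Proof.
split=> [|f g If Ig]; first exact: ideal_span0.
by rewrite addrC -[- g]mulN1r; apply: (ideal_span_linear (-1)).
Qed.

HB.instance Definition _ := GRing.isZmodClosed.Build S ideal_span ideal_span_zmod.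

Lemma ideal_spanM c f : f \in ideal_span -> c * f \in ideal_span.
Proof.
by move=> If; rewrite -[c * f]addr0; apply: (ideal_span_linear c If ideal_span0).
Qed.

Definition ideal_quotient : Type := Quotient.quot ideal_span.
HB.instance Definition _ := GRing.Zmodule.on ideal_quotient.

Definition iq_pi (f : S) : ideal_quotient := \pi_(Quotient.quot ideal_span) f.
Definition iq_repr (x : ideal_quotient) : S :=
  repr (x : Quotient.quot ideal_span).

Lemma iq_reprK x : iq_pi (iq_repr x) = x.
Proof. exact: reprK. Qed.

Lemma iq_piP f g : (f - g \in ideal_span) <-> iq_pi f = iq_pi g.
Proof. by rewrite Quotient.idealrBE; split=> /eqP. Qed.

Lemma iq_piD f g : iq_pi (f + g) = iq_pi f + iq_pi g.
Proof. exact: (raddfD \pi_(Quotient.quot ideal_span)). Qed.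

Definition iq_scale (a : S) (x : ideal_quotient) := iq_pi (a * iq_repr x).


Lemma iq_pi_scale a f : iq_scale a (iq_pi f) = iq_pi (a * f).
Proof.
apply/iq_piP; rewrite -mulrBr; apply: ideal_spanM.
by apply/iq_piP; rewrite iq_reprK.
Qed.

Fact iq_scaleA a b x : iq_scale a (iq_scale b x) = iq_scale (a * b) x.
Proof. by rewrite {2}/iq_scale iq_pi_scale mulrA. Qed.

Fact iq_scale1 : left_id 1 iq_scale.
Proof. by move=> x; rewrite /iq_scale mul1r iq_reprK. Qed.

Fact iq_scaleDr : right_distributive iq_scale +%R.
Proof.
move=> a x y; rewrite -[x]iq_reprK -[y]iq_reprK -iq_piD !iq_pi_scale.
by rewrite -iq_piD mulrDr.
Qed.

Fact iq_scaleDl x : {morph iq_scale^~ x : a b / a + b}.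
Proof. by move=> a b; rewrite /iq_scale -iq_piD mulrDl. Qed.

HB.instance Definition _ :=
  GRing.Zmodule_isLmodule.Build S ideal_quotient
    iq_scaleA iq_scale1 iq_scaleDr iq_scaleDl.

End IdealQuotient.

Section SemigroupRing.
Variables (K : fieldType) (m : nat) (b : 'I_m -> nat).
Local Notation S := {mpoly K[m]}.

(* The K-algebra map S -> K[t], x_i |-> t^(b_i). *)
Definition toric_map : S -> {poly K} := mmap polyC (fun i => 'X^(b i)).

(* K[H] for H = <b_1, ..., b_m>: the least K-subalgebra of K[t] containing all
   t^h with h in H. *)
Definition semigroup_algebra : {pred {poly K}} :=
  fun p => `[< forall A : {pred {poly K}}, GRing.subalg_closed A ->
                 (forall h, submonoid b h -> 'X^h \in A) -> p \in A >].

Lemma semigroup_algebra_subalg : GRing.subalg_closed semigroup_algebra.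
Proof.
split.
- by apply/asboolP => A [A1 _ _] _.
- move=> c p q /asboolP Hp /asboolP Hq; apply/asboolP => A HA AX.
  by case: (HA) => _ HL _; apply: HL; [apply: Hp|apply: Hq].
- move=> p q /asboolP Hp /asboolP Hq; apply/asboolP => A HA AX.
  by case: (HA) => _ _ HM; apply: HM; [apply: Hp|apply: Hq].
Qed.

HB.instance Definition _ :=
  GRing.isSubalgClosed.Build K {poly K} semigroup_algebra
    semigroup_algebra_subalg.

Lemma toric_map_in f : toric_map f \in semigroup_algebra.
Proof.
rewrite /toric_map /mmap rpred_sum // => mn _.
rewrite rpredM //; first by rewrite -alg_polyC rpredZ ?rpred1.
rewrite /mmap1 rpred_prod // => i _; apply: rpredX.
apply/asboolP => A HA; apply; exists (fun j => (j == i : nat)).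
rewrite (bigD1 i) ?inE //= eqxx mul1n big1 ?addn0 // => j /andP[_ /negPf ->].
by rewrite mul0n.
Qed.

(* K[H] as a type, made an S-module below through toric_map. *)
Record semigroup_ring : Type := SemigroupRing {
  sgr_val : {poly K};
  sgr_valP : sgr_val \in semigroup_algebra
}.

HB.instance Definition _ := [isSub for sgr_val].
HB.instance Definition _ := [Choice of semigroup_ring by <:].
HB.instance Definition _ := [SubChoice_isSubZmodule of semigroup_ring by <:].

Lemma toric_mapM_in f p :
  p \in semigroup_algebra -> toric_map f * p \in semigroup_algebra.
Proof. by move=> Hp; rewrite rpredM ?toric_map_in. Qed.

Definition sgr_scale (f : S) (x : semigroup_ring) : semigroup_ring :=
  SemigroupRing (toric_mapM_in f (sgr_valP x)).

Fact sgr_scaleA f g x : sgr_scale f (sgr_scale g x) = sgr_scale (f * g) x.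
Proof. by apply: val_inj; rewrite /= /toric_map rmorphM mulrA. Qed.

Fact sgr_scale1 : left_id 1 sgr_scale.
Proof. by move=> x; apply: val_inj; rewrite /= /toric_map rmorph1 mul1r. Qed.

Fact sgr_scaleDr : right_distributive sgr_scale +%R.
Proof. by move=> f x y; apply: val_inj; rewrite /= mulrDr. Qed.

Fact sgr_scaleDl x : {morph sgr_scale^~ x : f g / f + g}.
Proof.
by move=> f g; apply: val_inj; rewrite /= /toric_map rmorphD mulrDl.
Qed.

HB.instance Definition _ :=
  GRing.Zmodule_isLmodule.Build S semigroup_ring
    sgr_scaleA sgr_scale1 sgr_scaleDr sgr_scaleDl.

Definition toric_ideal : set S := [set f | toric_map f = 0].

(* Least total degree of a monomial of f, for f != 0; msize is a strict upper
   bound of these degrees. *)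
Definition initial_degree (f : S) : nat :=
  \big[minn/msize f]_(mn <- msupp f) mdeg mn.

Definition initial_form (f : S) : S := pihomog mdeg (initial_degree f) f.

(* S / I^*, presenting gr_m K[H]. *)
Definition tangent_cone : Type :=
  ideal_quotient
    [set g | exists f, [/\ f != 0, toric_ideal f & g = initial_form f]].
HB.instance Definition _ := GRing.Lmodule.on tangent_cone.

End SemigroupRing.

Definition betti_semigroup_ring (K : fieldType) (m : nat) (b : 'I_m -> nat) :
    nat -> nat :=
  betti (semigroup_ring K b).

Definition betti_tangent_cone (K : fieldType) (m : nat) (b : 'I_m -> nat) :
    nat -> nat :=
  betti (tangent_cone K b).

(* Main.v *)
(* Write S' = S[y] and pick a monomial w = x^u of S with toric image t^d.  In
   both parts K[H] (resp. its tangent cone) is S'/(I S' + (f)), where S/I is K[L]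
   (resp. its tangent cone) and f is y^c - w (resp. its initial form).  As f is
   monic in y, it is regular on S'/I S', so the mapping cone of multiplication
   by f on the extension to S' of a free resolution of S/I resolves
   S'/(I S' + (f)).  Its differentials become block diagonal modulo the
   variables, since f has no constant term, and the homology dimensions add up.

   The ideals are computed by division with remainder by f in y.  A polynomial
   of y-degree < c in the toric ideal of H has all its coefficients in that of
   L, because the exponents d j, j < c, are distinct modulo c.  For the tangent
   cone, u is chosen of degree >= c; then division respects orders, and one
   takes the component of lowest degree of the division identity. *)

Require Import Defs.
From HB Require Import structures.
From mathcomp Require Import all_boot all_order all_algebra.
From mathcomp Require Import boolp classical_sets.
From mathcomp Require Import mpoly.
From mathcomp Require Import zify.

Set Implicit Arguments.
Unset Strict Implicit.
Unset Printing Implicit Defensive.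

Import GRing.Theory.
Local Open Scope ring_scope.

(** * Independence of Betti numbers from the resolution *)

(* A chain map phi with a homotopy left inverse psi is injective on homology;
   here only the three degrees around f and g are recorded. *)
Lemma homology_dim_le (K : fieldType) (p f f' q g g' : nat)
    (A0 : 'M[K]_(f, p)) (A : 'M[K]_(f', f))
    (B0 : 'M[K]_(g, q)) (B : 'M[K]_(g', g))
    (phi0 : 'M[K]_(p, q)) (phi : 'M[K]_(f, g)) (psi : 'M[K]_(g, f))
    (psi1 : 'M[K]_(g', f')) (h0 : 'M[K]_(p, f)) (h : 'M[K]_(f, f')) :
  A *m A0 = 0 -> B *m B0 = 0 ->
  phi *m B0 = A0 *m phi0 -> B *m psi = psi1 *m A ->
  phi *m psi = 1%:M + A0 *m h0 + h *m A ->
  (\rank (kermx A0) - \rank A <= \rank (kermx B0) - \rank B)%N.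
Proof.
move=> AA0 BB0 phiB0 Bpsi phipsi.
have sA : (A <= kermx A0)%MS by apply/sub_kermxP.
have sB : (B <= kermx B0)%MS by apply/sub_kermxP.
have lift_bnd (r : nat) (x : 'M[K]_(r, f)) : (x <= kermx A0)%MS ->
    (x *m phi <= B)%MS -> (x <= A)%MS.
  move=> /sub_kermxP xA0 /submxP[v xv].
  have -> : x = (v *m psi1 - x *m h) *m A.
    rewrite mulmxBl -!mulmxA -Bpsi [v *m _]mulmxA -xv -mulmxA phipsi.
    by rewrite !mulmxDr mulmx1 mulmxA xA0 mul0mx addr0 addrK.
  exact: submxMl.
(* [C] complements the boundaries in the cycles, so it is a copy of homology. By [lift_bnd], [phi]
   is injective on [C] and maps it to a space meeting [B] only in 0, so both fit independently into
   the kernel of [B0]. *)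
set C := (kermx A0 :\: A)%MS.
have sC : (C <= kermx A0)%MS by apply: diffmxSl.
have CA0 : (C :&: A = 0)%MS by apply: capmx_diff.
have rC : (\rank C + \rank A = \rank (kermx A0))%N.
  have -> : \rank A = \rank (kermx A0 :&: A)%MS by rewrite (capmx_idPr sA).
  by rewrite addnC mxrank_cap_compl.
have zero_of (r : nat) (v : 'M[K]_(r, f)) :
    (v <= C)%MS -> (v *m phi <= B)%MS -> v = 0.
  move=> vC vB; apply/eqP; rewrite -submx0 -CA0 sub_capmx vC /=.
  by apply: lift_bnd vB; apply: submx_trans vC sC.
have rCphi : \rank (C *m phi) = \rank C.
  apply/eqP; rewrite -(eqn_add2r (\rank (C :&: kermx phi)%MS)).
  rewrite mxrank_mul_ker (_ : (C :&: kermx phi)%MS = 0) ?mxrank0 ?addn0 //.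
  apply: zero_of; first exact: capmxSl.
  by have /sub_kermxP -> := capmxSr C (kermx phi); rewrite sub0mx.
have CB0 : (C *m phi :&: B = 0)%MS.
  have /submxP[v def_v] := capmxSl (C *m phi) B.
  suff vC0 : v *m C = 0 by rewrite def_v mulmxA vC0 mul0mx.
  apply: zero_of; first exact: submxMl.
  by rewrite -mulmxA -def_v capmxSr.
have sCB : (C *m phi + B <= kermx B0)%MS.
  rewrite addsmx_sub sB andbT; apply/sub_kermxP.
  rewrite -mulmxA phiB0 mulmxA.
  by have /sub_kermxP -> := sC; rewrite mul0mx.
rewrite -rC addnK -rCphi leq_subRL; last exact: mxrankS.
rewrite addnC -(mxrank_disjoint_sum CB0); exact: mxrankS.
Qed.

(** Dependent choice with an invariant [P] that guarantees the next step; the types vary with the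
    index because the matrices of a resolution change size. *)
Lemma dependent_recursion (T : nat -> Type) (P : forall i, T i -> Prop)
    (Q : forall i, T i -> T i.+1 -> Prop) :
  (exists x, P 0%N x) ->
  (forall i x, P i x -> exists2 y, Q i x y & P i.+1 y) ->
  exists2 x : forall i, T i, P 0%N (x 0%N) & forall i, Q i (x i) (x i.+1).
Proof.
move=> /cid[x0 Px0] step.
pose next i (x : {x : T i | P i x}) : {y : T i.+1 | P i.+1 y} :=
  let: exist2 y _ Py := cid2 (step i _ (svalP x)) in exist _ y Py.
pose x := fix x i : {x : T i | P i x} :=
  if i is j.+1 then next j (x j) else exist _ x0 Px0.
exists (fun i => sval (x i)) => // i; rewrite /= /next.
by case: (cid2 _).
Qed.

Section Comparison.
Variables (K : fieldType) (m : nat) (M : lmodType {mpoly K[m]}).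
Local Notation S := {mpoly K[m]}.
Implicit Types F G : free_resolution M.

Lemma rows_lift (r s t : nat) (A : 'M[S]_(r, s)) (D : 'M[S]_(t, s)) :
  (forall i, exists v, row i A = v *m D) -> exists B, A = B *m D.
Proof.
move=> /boolp.choice[v vP]; exists (\matrix_i v i); apply/row_matrixP => i.
by rewrite row_mul rowK vP.
Qed.

Lemma diff_diff F i : diff F i.+1 *m diff F i = 0.
Proof.
apply/row_matrixP => j; rewrite row0 row_mul; apply/exact_diff.
by exists (row j 1%:M); rewrite -row_mul mul1mx.
Qed.

(* The differential leaving degree i, shifted so that degree 0 needs no special
   case: there it is the map to the zero module. *)
Definition diffp F (i : nat) :
    'M[S]_(rk F i, if i is j.+1 then rk F j else 0) :=
  match i with 0 => 0 | j.+1 => diff F j end.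

(** In degree 0 the outgoing map is the augmentation, unlike in [diffp], so that cycles are
    boundaries in all degrees alike. *)
Definition cycle F (i : nat) : 'rV[S]_(rk F i) -> Prop :=
  match i with
  | 0 => fun u => aug F u = 0
  | j.+1 => fun u => u *m diff F j = 0
  end.

Lemma cycleP F i (u : 'rV_(rk F i)) :
  cycle u <-> exists v, u = v *m diff F i.
Proof. by case: i u => [|i] u; [apply: exact_aug|apply: exact_diff]. Qed.

Lemma cycle_boundary F i (u : 'rV_(rk F i.+1)) : cycle (u *m diff F i).
Proof. by apply/cycleP; exists u. Qed.

Definition preserves_cycles F G i (phi : 'M[S]_(rk F i, rk G i)) : Prop :=
  forall u : 'rV_(rk F i), cycle u -> cycle (u *m phi).

Lemma comparison_step F G i (phi : 'M[S]_(rk F i, rk G i)) :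
  preserves_cycles phi ->
  exists phi' : 'M[S]_(rk F i.+1, rk G i.+1),
    diff F i *m phi = phi' *m diff G i.
Proof.
move=> phiP; apply: rows_lift => j; apply/cycleP.
by rewrite row_mul; apply: phiP; rewrite rowE; apply: cycle_boundary.
Qed.

Lemma comparison_preserves F G i (phi : 'M[S]_(rk F i, rk G i))
    (phi' : 'M[S]_(rk F i.+1, rk G i.+1)) :
  diff F i *m phi = phi' *m diff G i -> preserves_cycles phi'.
Proof. by move=> E u /= u0; rewrite -mulmxA -E mulmxA u0 mul0mx. Qed.

Lemma linear_sum_delta r (phi : {linear 'rV[S]_r -> M}) (u : 'rV[S]_r) :
  phi u = \sum_i u 0 i *: phi (delta_mx 0 i).
Proof.
by rewrite {1}(row_sum_delta u) linear_sum; under eq_bigr do rewrite linearZ.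
Qed.

Lemma comparison0 F G : exists phi : 'M[S]_(rk F 0, rk G 0),
  forall u, aug G (u *m phi) = aug F u.
Proof.
have /boolp.choice[v vP] : forall i, exists v, aug G v = aug F (delta_mx 0 i).
  by move=> i; apply: aug_surj.
exists (\matrix_i v i) => u.
rewrite mulmx_sum_row linear_sum [RHS]linear_sum_delta.
by apply: eq_bigr => i _; rewrite linearZ rowK vP.
Qed.

Lemma comparison F G : exists2 phi : forall i, 'M[S]_(rk F i, rk G i),
  forall u, aug G (u *m phi 0%N) = aug F u &
  forall i, diff F i *m phi i = phi i.+1 *m diff G i.
Proof.
(* The invariant is what the next degree needs: in degree 0 the map lies over the identity of M,
   afterwards it sends cycles to cycles. *)
have [|i phi phiP|phi phi0 phiS] := @dependent_recursion
  (fun i => 'M[S]_(rk F i, rk G i))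
  (fun i => if i is 0 then fun phi => forall u, aug G (u *m phi) = aug F u
            else fun phi => preserves_cycles phi)
  (fun i phi phi' => diff F i *m phi = phi' *m diff G i).
- exact: comparison0.
- have [|phi' E] := @comparison_step F G i phi.
    by case: i phi phiP => [|i] phi phiP //= u /= u0; rewrite phiP.
  by exists phi' => //; apply: comparison_preserves E.
- by exists phi.
Qed.

(** The rows of the defect [theta i.+1 - diff F i *m h i] are cycles, which exactness turns into
    boundaries; lifting them gives the next [h]. *)
Lemma null_homotopy F (theta : forall i, 'M[S]_(rk F i, rk F i)) :
  (forall u, aug F (u *m theta 0%N) = 0) ->
  (forall i, diff F i *m theta i = theta i.+1 *m diff F i) ->
  exists2 h : forall i, 'M[S]_(rk F i, rk F i.+1),
    theta 0%N = h 0%N *m diff F 0%N &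
    forall i, theta i.+1 = diff F i *m h i + h i.+1 *m diff F i.+1.
Proof.
move=> theta0 thetaS.
have [|i h hP|h h0 hS] := @dependent_recursion
  (fun i => 'M[S]_(rk F i, rk F i.+1))
  (fun i => match i return 'M[S]_(rk F i, rk F i.+1) -> Prop with
    | 0 => fun h => theta 0%N = h *m diff F 0%N
    | j.+1 => fun h => diff F j.+1 *m (theta j.+1 - h *m diff F j.+1) = 0
    end)
  (fun i h h' => theta i.+1 = diff F i *m h + h' *m diff F i.+1).
- have [|h0 ->] := @rows_lift _ _ _ (theta 0%N) (diff F 0%N); last by exists h0.
  by move=> j; apply/exact_aug; rewrite rowE.
- have hP' : diff F i *m (theta i - h *m diff F i) = 0.
    case: i h hP => [|i] h hP //=; first by rewrite {1}hP subrr mulmx0.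
  have [|h' E] :=
      @rows_lift _ _ _ (theta i.+1 - diff F i *m h) (diff F i.+1).
    move=> j; apply/exact_diff; rewrite rowE -mulmxA mulmxBl -thetaS.
    by rewrite -[_ *m h *m _]mulmxA -mulmxBr hP' mulmx0.
  have E' : theta i.+1 = diff F i *m h + h' *m diff F i.+1.
    by rewrite -E addrC subrK.
  exists h' => //; rewrite E' -addrA subrr addr0.
  by rewrite mulmxA diff_diff mul0mx.
- by exists h.
Qed.

Local Notation constmx := (map_mx (mcoeff 0%MM)).

(** A matrix with no columns has everything in its kernel, so the general formula also covers degree
    0. *)
Lemma tor_dimE F i :
  tor_dim F i = (\rank (kermx (constmx (diffp F i))) - \rank (diffK F i))%N.
Proof.
case: i => [|i] //=; rewrite mxrank_ker.
have := rank_leq_col (constmx (0 : 'M[S]_(rk F 0, 0))).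
by rewrite leqn0 => /eqP ->; rewrite subn0.
Qed.

(** Both [phi] followed by [psi] and the identity lift the identity of M, so they are homotopic.
    Reduction modulo the variables gives the data for [homology_dim_le]; exchanging F and G then
    gives equality. *)
Lemma tor_dim_le F G i : (tor_dim F i <= tor_dim G i)%N.
Proof.
have [phi phi0 phiS] := comparison F G.
have [psi psi0 psiS] := comparison G F.
have [||h h0 hS] := @null_homotopy F (fun j => phi j *m psi j - 1%:M).
- by move=> u; rewrite mulmxBr mulmx1 mulmxA linearB /= psi0 phi0 subrr.
- by move=> j; rewrite mulmxBr mulmxA phiS mulmxBl mulmx1 mul1mx -!mulmxA psiS.
have diffKK H j : diffK H j *m constmx (diffp H j) = 0.
  rewrite -map_mxM; case: j => [|j] /=; first by rewrite mulmx0 map_mx0.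
  by rewrite diff_diff map_mx0.
rewrite !tor_dimE.
have [h' E] : exists h', phi i *m psi i
    = 1%:M + diffp F i *m h' + h i *m diff F i.
  case: i => [|i] /=; [exists 0|exists (h i)].
    by rewrite mulmx0 addr0 -h0 addrC subrK.
  by rewrite -addrA -hS addrC subrK.
have [phi' E'] : exists phi', phi i *m diffp G i = diffp F i *m phi'.
  case: (i) => [|j] /=; first by exists 0; rewrite !mulmx0.
  by exists (phi j); rewrite phiS.
apply: (@homology_dim_le _ _ _ _ _ _ _ _ _ _ _ (constmx phi')
         (constmx (phi i)) (constmx (psi i)) (constmx (psi i.+1))
         (constmx h') (constmx (h i))); rewrite ?diffKK //.
- by rewrite -!map_mxM E'.
- by rewrite -!map_mxM psiS.
- by rewrite -!map_mxM E !map_mxD map_mx1.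
Qed.

Lemma bettiE F i : betti M i = tor_dim F i.
Proof.
rewrite /betti; case: xgetP => [b _ [G ->]|/(_ (tor_dim F i)) []].
  by apply/eqP; rewrite eqn_leq !tor_dim_le.
by exists F.
Qed.

End Comparison.
(** * Hilbert's basis theorem *)

Section Noetherian.
Variable R : comNzRingType.
Implicit Types V W : lmodType R.

Definition submodule V (N : V -> Prop) : Prop :=
  N 0 /\ forall c x y, N x -> N y -> N (c *: x + y).

(** Stated as the least submodule containing [s], so that membership is used by choosing a submodule
    instead of handling linear combinations. *)
Definition span V (s : seq V) (x : V) : Prop :=
  forall N, submodule N -> {in s, forall g, N g} -> N x.

Definition finitely_generated V (N : V -> Prop) : Prop :=
  exists2 s : seq V, {in s, forall g, N g} & forall x, N x -> span s x.

Lemma submodule_span V (s : seq V) : submodule (span s).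
Proof.
split=> [N [N0 _] _ //|c x y sx sy N NN sN].
by case: (NN) => _; apply; [apply: sx|apply: sy].
Qed.

Lemma span_mem V (s : seq V) g : g \in s -> span s g.
Proof. by move=> gs N _; apply. Qed.

Lemma span_sub V (s t : seq V) :
  {subset s <= t} -> forall x, span s x -> span t x.
Proof. by move=> st x sx N NN tN; apply: sx => // g /st; apply: tN. Qed.

Lemma submoduleB V (N : V -> Prop) : submodule N ->
  forall x y, N x -> N y -> N (x - y).
Proof. by move=> [_ NN] x y Nx Ny; rewrite -scaleN1r addrC; apply: NN. Qed.

Lemma submoduleD V (N : V -> Prop) : submodule N ->
  forall x y, N x -> N y -> N (x + y).
Proof. by move=> [_ NN] x y Nx Ny; rewrite -[x]scale1r; apply: NN. Qed.

Lemma submoduleZ V (N : V -> Prop) : submodule N ->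
  forall c x, N x -> N (c *: x).
Proof. by move=> [N0 NN] c x Nx; rewrite -[_ *: _]addr0; apply: NN. Qed.

Lemma seq_lift (T U : eqType) (P : T -> U -> Prop) (s : seq U) :
  {in s, forall y, exists x, P x y} ->
  exists t : seq T, {in t, forall x, exists2 y, y \in s & P x y} /\
                    {in s, forall y, exists2 x, x \in t & P x y}.
Proof.
elim: s => [|y s IHs] sP; first by exists [::].
have [x Pxy] := sP y (mem_head _ _).
have [z zs|t [tP1 tP2]] := IHs; first by apply: sP; rewrite in_cons zs orbT.
exists (x :: t); split=> z; rewrite in_cons => /predU1P[->|].
- by exists y; rewrite ?mem_head.
- by move=> /tP1[z' z's Pz]; exists z' => //; rewrite in_cons z's orbT.
- by exists x; rewrite ?mem_head.
- by move=> /tP2[z' z's Pz]; exists z' => //; rewrite in_cons z's orbT.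
Qed.

Lemma finitely_generated_ext V W (f : {linear V -> W}) (N : V -> Prop) :
  submodule N ->
  finitely_generated (fun y => exists x, N x /\ f x = y) ->
  finitely_generated (fun x => N x /\ f x = 0) ->
  finitely_generated N.
Proof.
move=> NN [s sN sgen] [t tN tgen].
have [s' [s'P1 s'P2]] := seq_lift (P := fun x y => N x /\ f x = y) sN.
exists (s' ++ t) => [g|x Nx].
  by rewrite mem_cat => /orP[/s'P1[y _ []]|/tN[]].
have [x' [Nx' sx' fx']] : exists x', [/\ N x', span (s' ++ t) x' & f x' = f x].
  have Nfx : exists x0, N x0 /\ f x0 = f x by exists x.
  apply: (sgen _ Nfx
    (fun y => exists x', [/\ N x', span (s' ++ t) x' & f x' = y])).
    split.
      exists 0; split; [by case: NN| |by rewrite linear0].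
      by case: (submodule_span (s' ++ t)).
    move=> c _ _ [x1 [N1 s1 <-]] [x2 [N2 s2 <-]].
    exists (c *: x1 + x2); split; last by rewrite linearP.
      by case: NN => _; apply.
    by case: (submodule_span (s' ++ t)) => _; apply.
  move=> y /s'P2[x' x's [Nx' fx']]; exists x'; split=> //.
  by apply: span_mem; rewrite mem_cat x's.
have -> : x = x' + (x - x') by rewrite addrC subrK.
apply: (submoduleD (submodule_span _)) => //.
apply: (@span_sub _ t); first by move=> g gt; rewrite mem_cat gt orbT.
apply: tgen; split; first exact: submoduleB.
by rewrite linearB /= fx' subrr.
Qed.

Definition noetherian_ring : Prop :=
  forall N : R^o -> Prop, submodule N -> finitely_generated N.

Lemma noetherian_rV r (N : 'rV[R]_r -> Prop) :
  noetherian_ring -> submodule N -> finitely_generated N.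
Proof.
move=> noethR.
(* Induction on the number k of leading coordinates that may be nonzero on N: the last of these maps
   N onto an ideal, and the kernel has one fewer. *)
suff fgN k : submodule N ->
    (forall u, N u -> forall i : 'I_r, (k <= i)%N -> u 0 i = 0) ->
    finitely_generated N.
  by move=> NN; apply: (fgN r) => // u _ i; rewrite leqNgt ltn_ord.
elim: k N => [|k IHk] N NN Nk.
  exists [::] => // u Nu; rewrite (_ : u = 0).
    by case: (submodule_span (Nil 'rV[R]_r)).
  by apply/rowP => i; rewrite mxE Nk.
have [lt_kr|le_rk] := ltnP k r; last first.
  apply: IHk => // u Nu i le_ki; case/negP: (ltn_geF (ltn_ord i)).
  exact: leq_trans le_rk le_ki.
pose k0 := Ordinal lt_kr.
pose coord (u : 'rV[R]_r) : R^o := u 0 k0.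
have coord_lin : linear coord by move=> c u v; rewrite /coord !mxE.
pose coordL := GRing.isLinear.Build R 'rV[R]_r R^o _ coord coord_lin.
pose f : {linear 'rV[R]_r -> R^o} := HB.pack coord coordL.
apply: (finitely_generated_ext (f := f)) => //.
- apply: noethR; split; first by exists 0; rewrite linear0; case: NN.
  move=> c _ _ [x [Nx <-]] [y [Ny <-]]; exists (c *: x + y); rewrite linearP.
  by split=> //; case: NN => _; apply.
- apply: IHk.
    split; first by split; [case: NN|rewrite linear0].
    move=> c x y [Nx fx] [Ny fy]; split; first by case: NN => _; apply.
    by rewrite linearP fx fy scaler0 addr0.
  move=> u [Nu fu] i; rewrite leq_eqVlt => /predU1P[def_k|/Nk]; last exact.
  by move: fu; rewrite /= /coord; congr (u _ _ = _); apply: val_inj.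
Qed.


(** Generators become the rows of a matrix, the shape in which [free_resolution] states
    exactness. *)
Lemma rV_generators r (N : 'rV[R]_r -> Prop) : noetherian_ring ->
  submodule N -> exists k (D : 'M[R]_(k, r)),
    forall u : 'rV_r, N u <-> exists v, u = v *m D.
Proof.
move=> noethR NN; have [s sN sgen] := noetherian_rV noethR NN.
exists (size s), (\matrix_(i < size s) s`_i) => u; split=> [Nu|[v ->]].
  apply: (sgen u Nu (fun u => exists v, u = v *m _)) => [|g gs].
    split; first by exists 0; rewrite mul0mx.
    move=> c _ _ [v1 ->] [v2 ->]; exists (c *: v1 + v2).
    by rewrite mulmxDl scalemxAl.
  have lt_gs : (index g s < size s)%N by rewrite index_mem.
  exists (delta_mx 0 (Ordinal lt_gs)); rewrite -rowE rowK /= nth_index //.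
rewrite mulmx_sum_row; case: (NN) => N0 _.
elim/big_rec: _ => // i x _ Nx; case: NN => _; apply=> //.
by rewrite rowK; apply: sN; rewrite mem_nth.
Qed.

End Noetherian.

Lemma noetherian_surj (R T : comNzRingType) (phi : {rmorphism R -> T}) :
  (forall y, exists x, phi x = y) -> noetherian_ring R -> noetherian_ring T.
Proof.
move=> phi_surj noethR N NN; have [|s sN sgen] := noethR (fun x => N (phi x)).
  split=> [|c x y Nx Ny]; first by rewrite rmorph0; case: NN.
  by rewrite rmorphD rmorphM; case: NN => _; apply.
exists (map phi s : seq T^o) => [_ /mapP[g /sN Ng ->] //|y Ny].
have [x def_y] := phi_surj y; rewrite -{}def_y in Ny *.
move=> N' NN' sN'; apply: (sgen x Ny (fun x => N' (phi x))) => [|g gs].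
- split=> [|c x1 x2 N1 N2]; first by rewrite rmorph0; case: NN'.
  by rewrite rmorphD rmorphM; case: NN' => _; apply.
- by apply: sN'; apply: map_f.
Qed.

Lemma noetherian_field (K : fieldType) : noetherian_ring K.
Proof.
move=> N NN; have [[x Nx x0]|N0] := pselect (exists2 x, N x & x != 0).
  exists [:: x] => [g|y _]; first by rewrite inE => /eqP->.
  rewrite -[y](divfK x0); apply: (submoduleZ (submodule_span _)).
  by apply: span_mem; rewrite inE.
exists [::] => // x Nx; rewrite (_ : x = 0).
  by case: (submodule_span (Nil K^o)).
by have [//|x0] := eqVneq x 0; case: N0; exists x.
Qed.

Section HilbertBasis.
Variables (R : comNzRingType) (N : {poly R}^o -> Prop).
Hypotheses (noethR : noetherian_ring R) (NN : submodule N).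

(** For a submodule N', the leading coefficients of its elements of degree k, together with 0, which
    comes from smaller degrees. *)
Let lead (k : nat) (N' : {poly R}^o -> Prop) (c : R^o) : Prop :=
  exists p : {poly R}, [/\ N' p, (size p <= k.+1)%N & p`_k = c].

Let lead_submodule k (N' : {poly R}^o -> Prop) :
  submodule N' -> submodule (lead k N').
Proof.
move=> NN'; split.
  by exists 0; rewrite size_poly0 coef0; split=> //; case: NN'.
move=> c _ _ [p [Np sp <-]] [q [Nq sq <-]]; exists (c%:P * p + q); split.
- by case: NN' => _; apply.
- rewrite (leq_trans (size_polyD _ _)) // geq_max sq andbT mul_polyC.
  by rewrite (leq_trans (size_scale_leq _ _)).
- by rewrite coefD coefCM.
Qed.

Let lead_shift k l (N' : {poly R}^o -> Prop) c :
  submodule N' -> (k <= l)%N -> lead k N' c -> lead l N' c.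
Proof.
move=> NN' le_kl [p [Np sp <-]]; exists ('X^(l - k) * p); split.
- exact: (submoduleZ NN').
- rewrite (leq_trans (size_polyMleq _ _)) // size_polyXn addSn /=.
  by rewrite -{2}(subnK le_kl) -addnS leq_add2l.
- by rewrite coefXnM ltnNge leq_subr /= subKn.
Qed.

Lemma hilbert_basis_ideal : finitely_generated N.
Proof.
have [|s sN sgen] := noethR (N := fun c => exists k, lead k N c).
  split; first by exists 0%N; case: (lead_submodule 0 NN).
  move=> c x y [k kx] [l ly]; exists (maxn k l).
  case: (lead_submodule (maxn k l) NN) => _; apply.
    by apply: lead_shift kx => //; rewrite leq_maxl.
  by apply: lead_shift ly => //; rewrite leq_maxr.
(* Multiplying by powers of X brings the generators of the ideal of all leading coefficients to one
   degree [m], from which on the ideals [lead k N] stop growing. *)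
have [m sm] : exists m, {in s, forall c, lead m N c}.
  elim: (s) sN => [|c s' IHs] sN; first by exists 0%N.
  have [k kc] := sN c (mem_head _ _).
  have [d ds|m sm] := IHs; first by apply: sN; rewrite in_cons ds orbT.
  exists (maxn k m) => d; rewrite in_cons => /predU1P[->|/sm md].
    by apply: lead_shift kc => //; rewrite leq_maxl.
  by apply: lead_shift md => //; rewrite leq_maxr.
have /boolp.choice[t tP] : forall k, exists t : seq {poly R}^o,
    {in t, forall p, N p} /\
    forall c, lead k N c -> lead k (span t) c.
  move=> k; have [s' s'N s'gen] := noethR (lead_submodule k NN).
  have [t [t1 t2]] := seq_lift (P := fun (p : {poly R}) c =>
    [/\ N p, (size p <= k.+1)%N & p`_k = c]) s'N.
  exists t; split=> [p /t1[y _ []] //|c kc].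
  apply: (s'gen c kc); first by apply: lead_submodule; apply: submodule_span.
  by move=> y /t2[p pt [Np sp pk]]; exists p; split=> //; apply: span_mem.
(* One finite list suffices: for k at most m it contains elements realising generators of
   [lead k N], and larger k reduce to m. *)
pose u : seq {poly R}^o := flatten [seq t k | k <- iota 0 m.+1].
have u_mem k : (k <= m)%N -> {subset t k <= u}.
  by move=> le_km p pt; apply/flatten_mapP; exists k; rewrite ?mem_iota.
have uN : {in u, forall p, N p}.
  by move=> p /flatten_mapP[k _ pt]; case: (tP k) => tN _; apply: tN.
have lead_u k c : lead k N c -> lead k (span u) c.
  have lead_u_le l d : (l <= m)%N -> lead l N d -> lead l (span u) d.
    move=> /u_mem lu /(proj2 (tP l)) [p [sp ? ?]]; exists p; split=> //.
    exact: span_sub lu _ sp.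
  have [|lt_mk kc] := leqP k m; first exact: lead_u_le.
  apply: (lead_shift _ (ltnW lt_mk)); first exact: submodule_span.
  apply: lead_u_le => //; apply: (sgen c); first by exists k.
    exact: lead_submodule.
  exact: sm.
(* Induction on a bound for the size: some element of the span of [u] has the same top coefficient,
   and subtracting it lowers the bound. *)
exists u => // p Np; move: {2}(size p) (leqnn (size p)) => k.
elim: k p Np => [|k IHk] p Np sp.
  move: sp; rewrite leqn0 size_poly_eq0 => /eqP->.
  by case: (submodule_span u).
have [|q [uq sq qk]] := lead_u k p`_k; first by exists p.
have -> : p = q + (p - q) by rewrite addrC subrK.
apply: (submoduleD (submodule_span _)) => //.
apply: IHk; first by apply: submoduleB => //; apply: uq.
apply/leq_sizeP => j; rewrite leq_eqVlt => /predU1P[<-|lt_kj].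
  by rewrite coefB qk subrr.
by rewrite coefB !nth_default ?subrr // (leq_trans _ lt_kj).
Qed.

End HilbertBasis.

Lemma noetherian_poly (R : comNzRingType) :
  noetherian_ring R -> noetherian_ring {poly R}.
Proof. by move=> noethR N; apply: hilbert_basis_ideal. Qed.
(** * Polynomials in the last variable *)

Lemma mpoly_rmorph_ext (R : comNzRingType) (n : nat) (T : comNzRingType)
    (f g : {rmorphism {mpoly R[n]} -> T}) :
  (forall c, f c%:MP = g c%:MP) -> (forall i, f 'X_i = g 'X_i) -> f =1 g.
Proof.
move=> fgC fgX p; rewrite (mpolyE p) !rmorph_sum; apply: eq_bigr => m _.
rewrite -mul_mpolyC !rmorphM fgC mpolyXE_id !rmorph_prod; congr (_ * _).
by apply: eq_bigr => i _; rewrite !rmorphXn fgX.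
Qed.

Section LastVariable.
Variables (R : comNzRingType) (n : nat).
Local Notation S := {mpoly R[n]}.
Local Notation S' := {mpoly R[n.+1]}.

Lemma muniX_last : muni ('X_ord_max : S') = 'X.
Proof.
rewrite muniE msuppX big_seq1 mcoeffX eqxx scale1r mnm1E eqxx expr1.
rewrite (_ : [multinom _ | _ < _] = 0%MM) ?mpolyX0 ?scale1r //.
apply/mnmP => i; rewrite !mnmE; case: eqP => // /(congr1 val) /= E.
by have := ltn_ord i; rewrite -E ltnn.
Qed.

Lemma muniX_widen (i : 'I_n) :
  muni ('X_(widen_ord (leqnSn n) i) : S') = ('X_i)%:P.
Proof.
rewrite muniE msuppX big_seq1 mcoeffX eqxx scale1r mnm1E.
rewrite (_ : _ == _ = false) ?expr0 -?alg_polyC; last first.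
  by apply/negbTE; rewrite -val_eqE /= neq_ltn ltn_ord.
congr ('X_[_]%:A); apply/mnmP => j; rewrite !mnmE -!val_eqE //.
Qed.

Lemma muni_mwiden (h : S) : muni (mwiden h) = h%:P.
Proof.
apply: (mpoly_rmorph_ext (f := @muni n R \o @mwiden n R)
          (g := polyC)) => /= [c|i].
  by rewrite mwidenC muniC.
by rewrite mwidenX mnmwiden1 muniX_widen.
Qed.

(** The inverse of [muni]. Both together identify S' with S[y], y being the last variable. *)
Definition unmuni (p : {poly S}) : S' :=
  (map_poly (@mwiden n R) p).['X_ord_max].

Lemma unmuni_monoid_morphism : monoid_morphism unmuni.
Proof.
by split=> [|p q]; rewrite /unmuni ?rmorph1 ?rmorphM ?hornerC ?hornerM.
Qed.

Lemma unmuni_zmod_morphism : zmod_morphism unmuni.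
Proof. by move=> p q; rewrite /unmuni rmorphB hornerD hornerN. Qed.

HB.instance Definition _ :=
  GRing.isZmodMorphism.Build {poly S} S' unmuni unmuni_zmod_morphism.
HB.instance Definition _ :=
  GRing.isMonoidMorphism.Build {poly S} S' unmuni unmuni_monoid_morphism.

Lemma unmuniC h : unmuni h%:P = mwiden h.
Proof. by rewrite /unmuni map_polyC hornerC. Qed.

Lemma unmuniX : unmuni 'X = 'X_ord_max.
Proof. by rewrite /unmuni map_polyX hornerX. Qed.

Lemma unmuniK : cancel unmuni (@muni n R).
Proof.
move=> p; rewrite -[p in LHS]coefK poly_def !rmorph_sum -[RHS]coefK poly_def.
apply: eq_bigr => i _; rewrite -!mul_polyC !rmorphM !rmorphXn /=.
by rewrite unmuniC unmuniX muniX_last muni_mwiden.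
Qed.

Lemma muniK : cancel (@muni n R) unmuni.
Proof.
apply: (mpoly_rmorph_ext (f := unmuni \o @muni n R) (g := idfun)) => /= [c|i].
  by rewrite muniC unmuniC mwidenC.
have [j ->|->] := unliftP ord_max i; last by rewrite muniX_last unmuniX.
rewrite (_ : lift _ j = widen_ord (leqnSn n) j); last exact/val_inj/lift_max.
by rewrite muniX_widen unmuniC mwidenX mnmwiden1.
Qed.

Lemma muni_sum (g : S') :
  g = \sum_(j < size (muni g)) mwiden (muni g)`_j * 'X_ord_max ^+ j.
Proof.
rewrite -{1}[g]muniK -[muni g in LHS]coefK poly_def rmorph_sum.
apply: eq_bigr => j _.
by rewrite -mul_polyC rmorphM rmorphXn /= unmuniC unmuniX.
Qed.

(** Connects the two views of S': total degree is read off monomials, division off coefficients in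
    y. *)
Lemma mcoeff_coef_muni (g : S') j m :
  (muni g)`_j@_m = g@_(mnmwiden m + U_(ord_max) *+ j)%MM.
Proof.
rewrite muniE coef_sum raddf_sum [in RHS](mpolyE g) raddf_sum /=.
apply: eq_bigr => m' _; rewrite coefZ coefXn mcoeffZ mcoeffX.
have [->|neq] := eqVneq m' (mnmwiden m + U_(ord_max) *+ j)%MM.
  rewrite mnmDE mulmnE mnmwiden_ordmax mnm1E eqxx add0n mul1n eqxx !mulr1.
  rewrite mcoeffZ mcoeffX (_ : [multinom _ | _ < _] = m) ?eqxx ?mulr1 //.
  apply/mnmP => i.
  rewrite mnmE mnmDE mulmnE mnm1E mnmwiden_widen -val_eqE /=.
  by rewrite (gtn_eqF (ltn_ord i)) mul0n addn0.
rewrite mulr0; case: eqP => [def_j|_]; rewrite ?mulr0 ?mcoeff0 // mulr1.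
rewrite mcoeffZ mcoeffX; case: eqP => [def_m|_]; rewrite ?mulr0 //.
case/eqP: neq; apply/mnmP => i; rewrite mnmDE mulmnE mnm1E.
have [i' ->|->] := unliftP ord_max i; last first.
  by rewrite mnmwiden_ordmax eqxx mul1n.
rewrite (_ : lift _ i' = widen_ord (leqnSn n) i'); last exact/val_inj/lift_max.
rewrite mnmwiden_widen -def_m mnmE -val_eqE /=.
by rewrite (gtn_eqF (ltn_ord i')) mul0n addn0.
Qed.

End LastVariable.

Lemma noetherian_mpoly (K : fieldType) n : noetherian_ring {mpoly K[n]}.
Proof.
elim: n => [|n IHn].
  apply: (@noetherian_surj K {mpoly K[0]} (@mpolyC 0 K)) => [p|]; last first.
    exact: noetherian_field.
  exists p@_0%MM; apply/mpolyP => m; rewrite mcoeffC.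
  by rewrite (_ : m = 0%MM) ?eqxx ?mulr1 //; apply/mnmP; case.
apply: (@noetherian_surj {poly {mpoly K[n]}} {mpoly K[n.+1]} (@unmuni K n)).
  by move=> g; exists (muni g); apply: muniK.
exact: noetherian_poly.
Qed.
(** * Resolutions and mapping cones *)

Section PresentationResolution.
Variables (K : fieldType) (m : nat) (M : lmodType {mpoly K[m]}).
Local Notation S := {mpoly K[m]}.
Variables (r : nat) (p : {linear 'rV[S]_r -> M}).
Hypothesis p_surj : forall y, exists u, p u = y.

Lemma submodule_kernel (V : lmodType S) (f : {linear 'rV[S]_r -> V}) :
  submodule (fun u => f u = 0).
Proof.
by split=> [|c x y fx fy]; rewrite ?linear0 // linearP fx fy scaler0 addr0.
Qed.

Lemma submodule_kermx (s t : nat) (A : 'M[S]_(s, t)) :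
  submodule (fun u : 'rV_s => u *m A = 0).
Proof.
split=> [|c x y xA yA]; first by rewrite mul0mx.
by rewrite mulmxDl -scalemxAl xA yA scaler0 addr0.
Qed.

(** The number of generators of a syzygy module is known only after the preceding matrix is chosen;
    packing the sizes with the matrix allows the recursion. *)
Record arrow := Arrow { src : nat; tgt : nat; mx : 'M[S]_(src, tgt) }.

Definition syzygy_exists (s t : nat) (A : 'M[S]_(s, t)) :=
  cid (rV_generators (@noetherian_mpoly K m) (submodule_kermx A)).

Definition next_arrow (A : arrow) : arrow :=
  Arrow (sval (cid (svalP (syzygy_exists (mx A))))).

Definition first_arrow : arrow :=
  Arrow (sval (cid (svalP (cid
    (rV_generators (@noetherian_mpoly K m) (submodule_kernel p)))))).

Fixpoint arrows (i : nat) : arrow :=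
  if i is j.+1 then next_arrow (arrows j) else first_arrow.

Definition presentation_resolution : free_resolution M.
Proof.
refine (@FreeResolution K m M (fun i => tgt (arrows i)) p
          (fun i => mx (arrows i)) p_surj _ _).
- exact: (svalP (cid (svalP (cid
    (rV_generators (@noetherian_mpoly K m) (submodule_kernel p)))))).
- move=> i; exact: (svalP (cid (svalP (syzygy_exists (mx (arrows i)))))).
(* Left transparent: the rank in degree 0 and the augmentation must later compute to the given
   ones. *)
Defined.

End PresentationResolution.

Section Cone.
Variables (K : fieldType) (n : nat).
Local Notation S := {mpoly K[n]}.
Local Notation S' := {mpoly K[n.+1]}.
Local Notation mwmx := (map_mx (@mwiden n K)).

(** S' is free over S on the powers of y, so membership in the extension of an ideal or submodule is
    tested on these coefficients. *)
Definition ycoef (j : nat) (g : S') : S := (muni g)`_j.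

Lemma ycoef_zmod j : zmod_morphism (ycoef j).
Proof. by move=> g h; rewrite /ycoef rmorphB coefB. Qed.

HB.instance Definition _ j :=
  GRing.isZmodMorphism.Build S' S (ycoef j) (ycoef_zmod j).

Lemma ycoefMw j g h : ycoef j (g * mwiden h) = ycoef j g * h.
Proof. by rewrite /ycoef rmorphM /= muni_mwiden coefMC. Qed.

Lemma ycoefXn j k g :
  ycoef j ('X_ord_max ^+ k * g) = if (j < k)%N then 0 else ycoef (j - k) g.
Proof. by rewrite /ycoef rmorphM rmorphXn /= muniX_last coefXnM. Qed.

Lemma ycoef_inj g h : (forall j, ycoef j g = ycoef j h) -> g = h.
Proof. by move=> E; apply: (can_inj (@muniK K n)); apply/polyP. Qed.

Definition ycoefmx j (r : nat) (u : 'rV[S']_r) : 'rV[S]_r := map_mx (ycoef j) u.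

Lemma ycoefmxE j r (u : 'rV[S']_r) i k : ycoefmx j u i k = ycoef j (u i k).
Proof. by rewrite mxE. Qed.

Lemma ycoefmx_zmod j r : zmod_morphism (@ycoefmx j r).
Proof. by move=> u v; rewrite /ycoefmx map_mxB. Qed.

HB.instance Definition _ j r :=
  GRing.isZmodMorphism.Build 'rV[S']_r 'rV[S]_r
    (@ycoefmx j r) (@ycoefmx_zmod j r).

Lemma ycoefmxM j r s (u : 'rV[S']_r) (D : 'M[S]_(r, s)) :
  ycoefmx j (u *m mwmx D) = ycoefmx j u *m D.
Proof.
apply/rowP => i; rewrite ycoefmxE !mxE raddf_sum; apply: eq_bigr => k _.
by rewrite ycoefmxE mxE /= ycoefMw.
Qed.

Lemma ycoefmx_inj r (u v : 'rV[S']_r) :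
  (forall j, ycoefmx j u = ycoefmx j v) -> u = v.
Proof.
move=> E; apply/rowP => i; apply: ycoef_inj => j.
by rewrite -!ycoefmxE E.
Qed.

Lemma ycoefmx_bound r (u : 'rV[S']_r) :
  exists k, forall j, (k <= j)%N -> ycoefmx j u = 0.
Proof.
exists (\max_i size (muni (u 0%R i)))%N => j le_kj; apply/rowP => i.
rewrite ycoefmxE mxE /ycoef nth_default // (leq_trans _ le_kj) //.
exact: (leq_bigmax i).
Qed.

Lemma ycoefmx_lift r (k : nat) (v : nat -> 'rV[S]_r) :
  exists u : 'rV[S']_r, forall j, ycoefmx j u = if (j < k)%N then v j else 0.
Proof.
exists (\row_i unmuni (\poly_(j < k) v j 0 i)) => j; apply/rowP => i.
by rewrite ycoefmxE mxE /ycoef unmuniK coef_poly; case: ifP; rewrite ?mxE.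
Qed.

(** Flatness of S' over S in concrete form. Preimages are chosen coefficient by coefficient and
    assembled, as only finitely many coefficients are nonzero. *)
Lemma mwmx_image r s (D : 'M[S]_(s, r)) (P : 'rV[S]_r -> Prop) (u : 'rV[S']_r) :
  (forall x, P x <-> exists v, x = v *m D) ->
  (forall j, P (ycoefmx j u)) <-> exists v, u = v *m mwmx D.
Proof.
move=> PD; split=> [Pu|[v ->] j]; last first.
  by apply/PD; exists (ycoefmx j v); rewrite ycoefmxM.
have /boolp.choice[v vP] : forall j, exists v, ycoefmx j u = v *m D.
  by move=> j; apply/PD.
have [k uk] := ycoefmx_bound u; have [v' v'P] := ycoefmx_lift k v.
exists v'; apply: ycoefmx_inj => j; rewrite ycoefmxM v'P.
by case: ltnP => [_|/uk]; rewrite ?mul0mx.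
Qed.

Variables (c : nat) (w : S).
Hypotheses (c_gt0 : (0 < c)%N) (w0 : w@_0%MM = 0).
Let f : S' := 'X_ord_max ^+ c - mwiden w.

Lemma ycoef_fM j g :
  ycoef j (f * g) = (if (j < c)%N then 0 else ycoef (j - c) g) - w * ycoef j g.
Proof.
by rewrite mulrBl raddfB /= ycoefXn [mwiden w * g]mulrC ycoefMw [w * _]mulrC.
Qed.

Lemma ycoefmx_fZ j r (u : 'rV[S']_r) :
  ycoefmx j (f *: u) =
  (if (j < c)%N then 0 else ycoefmx (j - c) u) - w *: ycoefmx j u.
Proof.
apply/rowP => i; rewrite ycoefmxE mxE ycoef_fM.
by case: ifP => _; rewrite !mxE.
Qed.

(* In y-degree j + c the product reads u_j - w u_(j+c), so u_j is recovered from
   u_(j+c), starting from the vanishing top coefficients. *)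
Lemma f_regular r (P : 'rV[S]_r -> Prop) (u : 'rV[S']_r) : submodule P ->
  (forall j, P (ycoefmx j (f *: u))) -> forall j, P (ycoefmx j u).
Proof.
move=> PP Pfu; have [k uk] := ycoefmx_bound u.
have Pu t : forall j, (k <= j + t)%N -> P (ycoefmx j u).
  elim: t => [|t IHt] j le_k.
    by rewrite uk; [case: PP|rewrite -(addn0 j)].
  have -> : ycoefmx j u = ycoefmx (j + c) (f *: u) + w *: ycoefmx (j + c) u.
    by rewrite ycoefmx_fZ ltnNge leq_addl /= addnK subrK.
  apply: (submoduleD PP) => //; apply: (submoduleZ PP); apply: IHt.
  by rewrite (leq_trans le_k) // -addSnnS leq_add2r -addn1 leq_add2l.
by move=> j; apply: (Pu k); rewrite leq_addl.
Qed.

Variables (M : lmodType S) (N : lmodType S') (F : free_resolution M).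
Variable augN : {linear 'rV[S']_(rk F 0) -> N}.
Hypothesis augN_surj : forall y, exists u, augN u = y.
(** Presents N as the quotient by f of the extension of M to S', without constructing that
    extension. *)
Hypothesis augN_ker : forall u, augN u = 0 <->
  exists q, forall j, aug F (ycoefmx j (u - f *: q)) = 0.

Definition cone_rk (i : nat) : nat :=
  match i with 0 => rk F 0 | j.+1 => (rk F j.+1 + rk F j)%N end.

(** Degree j + 1 is F_(j+1) plus a shifted copy of F_j, which f maps back to degree j. The sign on
    the shifted differential makes consecutive maps compose to 0. *)
Definition cone_diff (i : nat) : 'M[S']_(cone_rk i.+1, cone_rk i) :=
  match i with
  | 0 => col_mx (mwmx (diff F 0)) f%:M
  | j.+1 => block_mx (mwmx (diff F j.+1)) 0 f%:M (- mwmx (diff F j))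
  end.

Lemma cone_exact_aug u : augN u = 0 <-> exists v, u = v *m cone_diff 0.
Proof.
split=> [/augN_ker[q uq]|[v ->]].
  have /(mwmx_image _ (exact_aug (f := F))) [v E] := uq.
  exists (row_mx v q); rewrite /= mul_row_col -E mul_mx_scalar.
  by rewrite subrK.
apply/augN_ker; exists (rsubmx v).
rewrite -[v in v *m _]hsubmxK /= mul_row_col mul_mx_scalar addrK.
by apply/(mwmx_image _ (exact_aug (f := F))); exists (lsubmx v).
Qed.

Lemma mwmx_exact i (u : 'rV[S']_(rk F i.+1)) :
  u *m mwmx (diff F i) = 0 <-> exists v, u = v *m mwmx (diff F i.+1).
Proof.
rewrite -(mwmx_image _ (exact_diff (f := F) (i := i))); split=> [E j|E].
  by rewrite -ycoefmxM E raddf0.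
by apply: ycoefmx_inj => j; rewrite ycoefmxM E raddf0.
Qed.

Lemma mwmx_diff_diff i : mwmx (diff F i.+1) *m mwmx (diff F i) = 0.
Proof. by rewrite -map_mxM diff_diff map_mx0. Qed.

Lemma cone_diff_diff i : cone_diff i.+1 *m cone_diff i = 0.
Proof.
case: i => [|i] /=.
  rewrite mul_block_col mwmx_diff_diff mul0mx addr0 mul_scalar_mx mul_mx_scalar.
  by rewrite scalerN subrr col_mx0.
rewrite mulmx_block !mwmx_diff_diff !mul0mx !mulmx0 !addr0 !mulNmx !mulmxN.
rewrite mwmx_diff_diff mul_scalar_mx mul_mx_scalar subrr !oppr0 ?addr0.
by rewrite block_mx_const.
Qed.

Lemma cone_exact_diff i (u : 'rV[S']_(cone_rk i.+1)) :
  u *m cone_diff i = 0 <-> exists v, u = v *m cone_diff i.+1.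
Proof.
split=> [|[v ->]]; last by rewrite -mulmxA cone_diff_diff mulmx0.
(* For a cycle (u1, u2), u2 is a boundary, say of v. Then u1 + f v is a cycle of the extension of F,
   hence the boundary of some v1, and (v1, -v) maps to (u1, u2). *)
suff [u1 [u2 [def_u P]]] : exists u1 u2, u = row_mx u1 u2 /\
    (u *m cone_diff i = 0 -> (exists v, u2 = v *m mwmx (diff F i)) /\
       u1 *m mwmx (diff F i) + f *: u2 = 0).
  move=> /P[[v def_u2] E].
  have /mwmx_exact[v1 E1] : (u1 + f *: v) *m mwmx (diff F i) = 0.
    by rewrite mulmxDl -scalemxAl -def_u2.
  exists (row_mx v1 (- v)); rewrite def_u /= mul_row_block -E1 mulmx0 add0r.
  by rewrite mul_mx_scalar scalerN addrK mulNmx mulmxN opprK def_u2.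
exists (lsubmx u), (rsubmx u); rewrite hsubmxK; split=> //.
case: i u => [|i] u /=; rewrite -{1}[u]hsubmxK.
  (* In the lowest degree only f u2 is known to be a boundary; regularity of f modulo boundaries
     yields u2 itself. *)
  rewrite mul_row_col mul_mx_scalar => E; split=> //.
  apply/(mwmx_image _ (exact_aug (f := F))).
  apply: (f_regular (P := fun x => aug F x = 0)); first exact: submodule_kernel.
  apply/(mwmx_image _ (exact_aug (f := F))); exists (- lsubmx u).
  by rewrite mulNmx; apply/eqP; rewrite -addr_eq0 addrC E.
rewrite mul_row_block mulmx0 add0r mul_mx_scalar -row_mx0.
move=> /eq_row_mx[E1 /eqP]; rewrite mulmxN oppr_eq0 => /eqP/mwmx_exact E2.
by split.
Qed.

Definition cone_resolution : free_resolution N :=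
  @FreeResolution K n.+1 N cone_rk augN cone_diff
    augN_surj cone_exact_aug cone_exact_diff.

Local Notation constmx := (map_mx (mcoeff 0%MM)).

Lemma mcoeff0_mwiden (h : S) : (mwiden h)@_0%MM = h@_0%MM.
Proof. by rewrite -[0%MM in LHS]mnmwiden0 mwiden_mnmwiden. Qed.

Lemma mcoeff0_f : f@_0%MM = 0.
Proof.
rewrite mcoeffB mcoeff0_mwiden w0 subr0 mcoeffXn.
case: eqP => // /mnmP/(_ ord_max); rewrite mulmnE mnm1E eqxx mul1n mnm0E.
by case: c c_gt0.
Qed.

Lemma constmx_mwmx r s (A : 'M[S]_(r, s)) : constmx (mwmx A) = constmx A.
Proof. by apply/matrixP => i j; rewrite !mxE; apply: mcoeff0_mwiden. Qed.

Lemma constmx_f r : constmx (f%:M : 'M_r) = 0.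
Proof. by rewrite map_scalar_mx /= mcoeff0_f raddf0. Qed.

Lemma rank_diffK_cone i : \rank (diffK cone_resolution i) =
  (\rank (diffK F i) + if i is j.+1 then \rank (diffK F j) else 0)%N.
Proof.
case: i => [|i]; rewrite /diffK /=.
  rewrite map_col_mx constmx_mwmx constmx_f rank_col_mx0 addn0 //.
rewrite map_block_mx !constmx_mwmx constmx_f map_mx0 rank_diag_block_mx.
by rewrite map_mxN constmx_mwmx mxrank_opp.
Qed.

Lemma rank_diffK_le (m : nat) (M' : lmodType {mpoly K[m]})
    (G : free_resolution M') i :
  (\rank (diffK G i.+1) + \rank (diffK G i) <= rk G i.+1)%N.
Proof.
apply: mulmx0_rank_max.
by rewrite /diffK -map_mxM diff_diff map_mx0.
Qed.

Lemma tor_dim_cone i :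
  tor_dim cone_resolution i.+1 = (tor_dim F i.+1 + tor_dim F i)%N.
Proof.
rewrite /= !mxrank_ker !rank_diffK_cone.
(* These bounds ensure that none of the truncated subtractions is cut off at 0. *)
have := rank_diffK_le F i; case: i => [|i] /=.
  have := rank_leq_col (diffK F 0).
  lia.
rewrite mxrank_ker; have := rank_diffK_le F i.
lia.
Qed.

Lemma betti_cone i : betti N i.+1 = (betti M i.+1 + betti M i)%N.
Proof. by rewrite (bettiE cone_resolution) !(bettiE F) tor_dim_cone. Qed.

End Cone.

(** * Cyclic modules and division by f in y *)

Section CyclicModules.
Variables (K : fieldType) (n : nat).
Local Notation S := {mpoly K[n]}.
Local Notation S' := {mpoly K[n.+1]}.
Variables (c : nat) (w : S).
Hypotheses (c_gt0 : (0 < c)%N) (w0 : w@_0%MM = 0).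
Let f : S' := 'X_ord_max ^+ c - mwiden w.

Definition on_rV1 (R : comNzRingType) (V : lmodType R) (p : R^o -> V)
  (u : 'rV[R]_1) : V := p (u 0 0).

Lemma on_rV1_linear (R : comNzRingType) (V : lmodType R)
    (p : {linear R^o -> V}) : linear (on_rV1 p).
Proof. by move=> a u v; rewrite /on_rV1 !mxE linearP. Qed.

HB.instance Definition _ (R : comNzRingType) (V : lmodType R)
    (p : {linear R^o -> V}) :=
  GRing.isLinear.Build R 'rV[R]_1 V _ (on_rV1 p) (on_rV1_linear p).

Lemma on_rV1_surj (R : comNzRingType) (V : lmodType R) (p : R^o -> V) :
  (forall y, exists x, p x = y) -> forall y, exists u, on_rV1 p u = y.
Proof.
move=> p_surj y; have [x <-] := p_surj y.
by exists x%:M; rewrite /on_rV1 mxE eqxx mulr1n.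
Qed.

Variables (M : lmodType S) (N : lmodType S').
Variables (pM : {linear S^o -> M}) (pN : {linear S'^o -> N}).
Hypothesis pM_surj : forall y, exists x, pM x = y.
Hypothesis pN_surj : forall y, exists x, pN x = y.
(** With I the kernel of [pM], this says that [pN] has kernel I S' + (f). *)
Hypothesis pN_ker : forall g, pN g = 0 <->
  exists q, forall j, pM (ycoef j (g - f * q)) = 0.

Lemma betti_gluing i : betti N i.+1 = (betti M i.+1 + betti M i)%N.
Proof.
pose F := presentation_resolution (on_rV1_surj pM_surj).
apply: (@betti_cone K n c w c_gt0 w0 M N F (on_rV1 pN)).
  exact: on_rV1_surj.
move=> u; rewrite /= /on_rV1 pN_ker; split=> [[q qP]|[q qP]].
  by exists q%:M => j; rewrite ycoefmxE !mxE eqxx mulr1n; apply: qP.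
by exists (q 0 0) => j; have := qP j; rewrite ycoefmxE !mxE.
Qed.

(* Eliminating y^c := w once per step in g gives the coefficients
   sum_s w^s g_(j + (s+1) c) of the quotient of g by f. *)
Definition quotient_f (g : S') : S' :=
  let k := size (muni g) in
  unmuni (\poly_(j < k) \sum_(s < k) w ^+ s * ycoef (j + s.+1 * c) g).

Lemma ycoef_ge (g : S') j : (size (muni g) <= j)%N -> ycoef j g = 0.
Proof. by move=> le_j; rewrite /ycoef nth_default. Qed.

Lemma ycoef_quotient g j :
  ycoef j (quotient_f g) =
  \sum_(s < size (muni g)) w ^+ s * ycoef (j + s.+1 * c) g.
Proof.
rewrite [LHS]/ycoef unmuniK coef_poly; case: ltnP => // le_j.
rewrite big1 // => s _; rewrite ycoef_ge ?mulr0 //.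
by rewrite (leq_trans le_j) ?leq_addr.
Qed.

Lemma ycoef_remainder g j : (c <= j)%N -> ycoef j (g - f * quotient_f g) = 0.
Proof.
move=> le_cj; rewrite raddfB /= (ycoef_fM c w) ltnNge le_cj /= !ycoef_quotient.
set k := size _; apply/eqP; rewrite subr_eq0 eq_sym subr_eq; apply/eqP.
(* Both sides equal this sum: its top term vanishes, as j + k c is beyond the y-degree of g, and its
   bottom term is [ycoef j g]. *)
transitivity (\sum_(s < k.+1) w ^+ s * ycoef (j + s * c) g).
  rewrite big_ord_recr /= [ycoef (j + k * c) g]ycoef_ge ?mulr0 ?addr0.
    by apply: eq_bigr => s _; rewrite mulSn addnA subnK.
  by rewrite (leq_trans _ (leq_addl _ _)) // leq_pmulr.
rewrite big_ord_recl expr0 mul1r mul0n addn0 mulr_sumr; congr (_ + _).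
by apply: eq_bigr => s _; rewrite /bump /= exprS mulrA.
Qed.
End CyclicModules.

(** * Semigroup rings *)

Section ToricMap.
Variables (K : fieldType) (m : nat) (b : 'I_m -> nat).
Local Notation S := {mpoly K[m]}.

Lemma toric_map_zmod : zmod_morphism (toric_map (K := K) b).
Proof. by move=> f g; rewrite /toric_map rmorphB. Qed.

Lemma toric_map_monoid : monoid_morphism (toric_map (K := K) b).
Proof. by split=> [|f g]; rewrite /toric_map ?rmorph1 ?rmorphM. Qed.

HB.instance Definition _ :=
  GRing.isZmodMorphism.Build S {poly K} (toric_map b) toric_map_zmod.
HB.instance Definition _ :=
  GRing.isMonoidMorphism.Build S {poly K} (toric_map b) toric_map_monoid.

Lemma toric_mapC (x : K) : toric_map b x%:MP = x%:P.
Proof. by rewrite /toric_map mmapC. Qed.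

Lemma toric_mapX u : toric_map (K := K) b 'X_[u] = 'X^(\sum_i b i * u i).
Proof.
rewrite /toric_map mmapX /mmap1 (big_morph _ (exprD _) (expr0 _)).
by apply: eq_bigr => i _; rewrite exprM.
Qed.

Definition sgr_pi (f : S^o) : semigroup_ring K b :=
  SemigroupRing (toric_map_in b f).

Lemma sgr_pi_linear : linear sgr_pi.
Proof. by move=> a f g; apply: val_inj; rewrite /= rmorphD rmorphM. Qed.

HB.instance Definition _ :=
  GRing.isLinear.Build S S^o (semigroup_ring K b) _ sgr_pi sgr_pi_linear.

Lemma sgr_pi_eq0 f : sgr_pi f = 0 <-> toric_map b f = 0.
Proof. by split=> [/(congr1 val) //|f0]; apply: val_inj. Qed.

Lemma sgr_pi_surj (y : semigroup_ring K b) : exists f, sgr_pi f = y.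
Proof.
suff [f Ef] : exists f, toric_map b f = val y by exists f; apply: val_inj.
(* K[H] is a least subalgebra, so it lies in the image of the toric map once that image is a
   subalgebra containing all t^h. *)
pose A : {pred {poly K}} :=
  fun p => `[< exists f, toric_map (K := K) b f = p >].
have /asboolP/(_ A) yA := valP y; apply/asboolP; apply: yA.
  split; first by apply/asboolP; exists 1; rewrite rmorph1.
    move=> x _ _ /asboolP[f <-] /asboolP[g <-]; apply/asboolP.
    by exists (x%:MP * f + g); rewrite rmorphD rmorphM /= toric_mapC mul_polyC.
  move=> _ _ /asboolP[f <-] /asboolP[g <-]; apply/asboolP.
  by exists (f * g); rewrite rmorphM.
move=> h [l ->]; apply/asboolP; exists 'X_[[multinom l i | i < m]].
rewrite toric_mapX; congr 'X^_; apply: eq_big => [i|i _]; first by rewrite inE.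
by rewrite mnmE mulnC.
Qed.

End ToricMap.

(** * The toric ideal of the gluing *)

Lemma coprime_residue (c d j j' k t : nat) : coprime c d ->
  (j < c)%N -> (j' < c)%N -> (c * k + d * j = c * t + d * j')%N -> j = j'.
Proof.
move=> co_cd; wlog le_jj : j j' k t / (j <= j')%N => [IH|] lt_j lt_j' E.
  have [|/ltnW] := leqP j j'; first by move=> le_jj; apply: IH E.
  by move=> le_jj; rewrite (IH _ _ _ _ le_jj lt_j' lt_j (esym E)).
apply/eqP; rewrite eqn_leq le_jj -subn_eq0.
suff : (c %| j' - j)%N.
  by rewrite /dvdn modn_small // (leq_ltn_trans (leq_subr _ _)).
rewrite -(Gauss_dvdr _ co_cd) mulnBr -(subnDl (c * t)) -E.
by rewrite subnDr -mulnBr dvdn_mulr.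
Qed.

Section GluingKernel.
Variables (K : fieldType) (n : nat) (a : 'I_n -> nat) (c d : nat).
Local Notation S := {mpoly K[n]}.
Local Notation S' := {mpoly K[n.+1]}.
Local Notation aH := (gluing a c d).
Hypotheses (c_gt0 : (0 < c)%N) (coprime_cd : coprime c d).

Lemma toric_gluing_mwiden (h : S) :
  toric_map aH (mwiden h) = toric_map a h \Po 'X^c.
Proof.
apply: (mpoly_rmorph_ext (f := toric_map aH \o @mwiden n K)
          (g := (comp_poly 'X^c) \o toric_map a)) => /= [x|i].
  by rewrite mwidenC !toric_mapC comp_polyC.
rewrite mwidenX mnmwiden1 /toric_map !mmapX !mmap1U comp_Xn_poly -exprM.
rewrite /gluing; case: unliftP => [j /(congr1 val) /=|/(congr1 val) /= E].
  by rewrite /bump leqNgt ltn_ord /= => /val_inj ->.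
by have := ltn_ord i; rewrite E ltnn.
Qed.

Lemma toric_gluing_last : toric_map aH ('X_ord_max : S') = 'X^d.
Proof. by rewrite /toric_map mmapX mmap1U /gluing unlift_none. Qed.

Lemma toric_gluing (g : S') : toric_map aH g =
  \sum_(j < size (muni g)) (toric_map a (ycoef j g) \Po 'X^c) * 'X^(d * j).
Proof.
rewrite {1}[g]muni_sum rmorph_sum; apply: eq_bigr => j _.
by rewrite rmorphM rmorphXn /= toric_gluing_last toric_gluing_mwiden exprM.
Qed.

Lemma toric_gluing_inj (g : S') :
  (forall j, (c <= j)%N -> ycoef j g = 0) -> toric_map aH g = 0 ->
  forall j, toric_map a (ycoef j g) = 0.
Proof.
move=> g_lt; rewrite toric_gluing => g0 j.
have [le_cj|lt_jc] := leqP c j; first by rewrite g_lt ?rmorph0.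
have [le_j|lt_j] := leqP (size (muni g)) j; first by rewrite ycoef_ge ?rmorph0.
apply/polyP => k; rewrite coef0.
(* The exponent c k + d j isolates the coefficient of t^k in the j-th term: by coprimality no other
   j' < c contributes to it. *)
have := congr1 (fun p : {poly K} => p`_(c * k + d * j)) g0.
rewrite coef0 coef_sum (bigD1 (Ordinal lt_j)) //= big1 => [|j' neq_j'].
  rewrite addr0 coefMXn ltnNge leq_addl /= addnK coef_comp_poly_Xn //.
  by rewrite dvdn_mulr // mulKn.
have [le_cj'|lt_j'c] := leqP c j'.
  by rewrite g_lt // rmorph0 comp_poly0 mul0r coef0.
rewrite coefMXn; case: ltnP => // le_dj'.
rewrite coef_comp_poly_Xn //; case: ifP => // /dvdnP[t E].
have {}E : (c * k + d * j = c * t + d * j')%N.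
  by rewrite -(subnK le_dj') E mulnC.
case/eqP: neq_j'; apply: val_inj => /=.
by rewrite (coprime_residue coprime_cd lt_jc lt_j'c E).
Qed.

Variable w : S.
Hypothesis toric_w : toric_map a w = 'X^d.
Let f : S' := 'X_ord_max ^+ c - mwiden w.

Lemma toric_gluing_f : toric_map aH f = 0.
Proof.
rewrite rmorphB rmorphXn /= toric_gluing_last toric_gluing_mwiden toric_w.
by rewrite comp_Xn_poly -!exprM mulnC subrr.
Qed.

Lemma toric_gluing_ker (g : S') : toric_map aH g = 0 <->
  exists q, forall j, toric_map a (ycoef j (g - f * q)) = 0.
Proof.
have E q : toric_map aH (g - f * q) = toric_map aH g.
  by rewrite rmorphB rmorphM /= toric_gluing_f mul0r subr0.
split=> [g0|[q qP]].
  exists (quotient_f c w g); apply: toric_gluing_inj; last by rewrite E.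
  by move=> j; apply: ycoef_remainder.
rewrite -(E q) toric_gluing big1 // => j _.
by rewrite qP comp_poly0 mul0r.
Qed.

Lemma betti_semigroup_ring_gluing : w@_0%MM = 0 -> forall i,
  betti_semigroup_ring K aH i.+1 =
  (betti_semigroup_ring K a i.+1 + betti_semigroup_ring K a i)%N.
Proof.
move=> w0 i; rewrite /betti_semigroup_ring.
apply: (@betti_gluing K n c w c_gt0 w0 (semigroup_ring K a)
          (semigroup_ring K aH) (sgr_pi a) (sgr_pi aH)).
- exact: sgr_pi_surj.
- exact: sgr_pi_surj.
move=> g /=; rewrite sgr_pi_eq0 toric_gluing_ker.
by split=> -[q qP]; exists q => j; apply/sgr_pi_eq0.
Qed.

End GluingKernel.
(** * Tangent cones *)

Section Order.
Variables (R : comNzRingType) (m : nat).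
Local Notation S := {mpoly R[m]}.

Lemma mcoeff_pihomog k (g : S) u :
  (pihomog mdeg k g)@_u = if mdeg u == k then g@_u else 0.
Proof.
rewrite pihomogE big_mkcond raddf_sum /= [in RHS](mpolyE g) raddf_sum /=.
case: ifP => [/eqP deg_u|/eqP deg_u]; last first.
  rewrite big1 // => v _; case: eqP => [deg_v|_]; last exact: mcoeff0.
  rewrite mcoeffZ mcoeffX; case: eqP => [uv|_]; rewrite ?mulr0 //.
  by rewrite uv in deg_v.
apply: eq_bigr => v _; case: eqP => // deg_v; rewrite mcoeff0.
rewrite mcoeffZ mcoeffX; case: eqP => [uv|_]; rewrite ?mulr0 //.
by rewrite uv in deg_v.
Qed.

(** Membership in the e-th power of the ideal of the variables; 0 satisfies it for all e. *)
Definition order_ge (e : nat) (g : S) : Prop :=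
  forall u, (mdeg u < e)%N -> g@_u = 0.

Lemma order_ge_leq e e' g : (e' <= e)%N -> order_ge e g -> order_ge e' g.
Proof. by move=> le_e ge_e u lt_u; apply: ge_e; apply: leq_trans lt_u le_e. Qed.

Lemma order_geB e g h : order_ge e g -> order_ge e h -> order_ge e (g - h).
Proof. by move=> ge_g ge_h u lt_u; rewrite mcoeffB ge_g ?ge_h ?subr0. Qed.

Lemma order_ge_sum e (I : Type) (r : seq I) (P : pred I) (F : I -> S) :
  (forall i, P i -> order_ge e (F i)) -> order_ge e (\sum_(i <- r | P i) F i).
Proof.
by move=> ge_F u lt_u; rewrite raddf_sum big1 // => i Pi; apply: ge_F.
Qed.

Lemma order_geM p q g h :
  order_ge p g -> order_ge q h -> order_ge (p + q) (g * h).
Proof.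
move=> ge_g ge_h u lt_u; rewrite mcoeffM.
rewrite big1 // => -[[v1 lt1] [v2 lt2]] /= /eqP def_u {lt1 lt2}.
have [lt_v1|le_v1] := ltnP (mdeg v1) p; first by rewrite ge_g ?mul0r.
have /= := congr1 mdeg def_u; rewrite mdegD => deg_u.
rewrite ge_h ?mulr0 //; move: lt_u; rewrite deg_u => lt_u.
by rewrite -(ltn_add2l p) (leq_ltn_trans _ lt_u) // leq_add2r.
Qed.

Lemma order_geX c w k : order_ge c w -> order_ge (k * c) (w ^+ k).
Proof.
move=> ge_w; elim: k => [|k IHk] //.
by rewrite mulSn exprS; apply: order_geM.
Qed.

(** Only the components of degrees p and q contribute in degree p + q: any other splitting puts one
    factor below its order. *)
Lemma pihomogM p q g h : order_ge p g -> order_ge q h ->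
  pihomog mdeg (p + q) (g * h) = pihomog mdeg p g * pihomog mdeg q h.
Proof.
move=> ge_g ge_h; apply/mpolyP => u; rewrite mcoeff_pihomog !mcoeffM.
case: eqP => deg_u; last first.
  rewrite big1 // => -[[v1 lt1] [v2 lt2]] /= /eqP def_u {lt1 lt2}.
  rewrite !mcoeff_pihomog.
  case: eqP => [d1|]; rewrite ?mul0r //; case: eqP => [d2|]; rewrite ?mulr0 //.
  by case: deg_u; have /= := congr1 mdeg def_u; rewrite mdegD d1 d2.
apply: eq_bigr => -[[v1 lt1] [v2 lt2]] /= /eqP def_u {lt1 lt2}.
rewrite !mcoeff_pihomog.
have /= := congr1 mdeg def_u; rewrite {}deg_u mdegD => deg_u.
have [lt1|gt1|eq1] := ltngtP (mdeg v1) p; first by rewrite ge_g ?mul0r.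
  by rewrite ge_h ?mulr0 ?mul0r // -(ltn_add2l p) deg_u ltn_add2r.
by rewrite (_ : mdeg v2 == q) //; rewrite -(eqn_add2l p) deg_u eq1.
Qed.

Lemma order_ge_pihomog e k g :
  order_ge e g -> (k < e)%N -> pihomog mdeg k g = 0.
Proof.
move=> ge_g lt_k; apply/mpolyP => u; rewrite mcoeff_pihomog mcoeff0.
by case: eqP => // deg_u; rewrite ge_g ?deg_u.
Qed.

End Order.

Section InitialForm.
Variables (K : fieldType) (m : nat).
Local Notation S := {mpoly K[m]}.
Implicit Type g : S.

Lemma initial_degree_le g u : g@_u != 0 -> (initial_degree g <= mdeg u)%N.
Proof.
rewrite -mcoeff_msupp /initial_degree.
elim: (msupp g : seq _) => [|v s IHs] //; rewrite inE big_cons.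
by case/predU1P => [->|/IHs]; rewrite geq_min ?leqnn // => ->; rewrite orbT.
Qed.

Lemma order_ge_initial_degree g : order_ge (initial_degree g) g.
Proof.
move=> u lt_u; apply/eqP; apply: contraLR lt_u => /initial_degree_le.
by rewrite -leqNgt.
Qed.

Lemma initial_degree_eq g e :
  order_ge e g -> pihomog mdeg e g != 0 -> initial_degree g = e.
Proof.
move=> ge_g /mlast_supp; rewrite mcoeff_msupp mcoeff_pihomog.
set u := mlast _; case: (mdeg u =P e) => [deg_u gu|_]; last by rewrite eqxx.
apply/eqP; rewrite eqn_leq -{1}deg_u initial_degree_le //=.
rewrite /initial_degree big_seq_cond.
elim/big_ind: _ => [|x y le_x le_y|v].
(* The default value [msize g] of the minimum exceeds the degree e of the monomial u of g, so it
   respects the bound. *)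
- by rewrite -deg_u ltnW // msize_mdeg_lt // mcoeff_msupp.
- by rewrite leq_min le_x.
- rewrite andbT mcoeff_msupp leqNgt; apply: contra => /ge_g ->.
  exact: eqxx.
Qed.

End InitialForm.

Lemma ideal_span_mem (S : comNzRingType) (G : set S) g :
  G g -> g \in ideal_span G.
Proof.
move=> Gg; apply/asboolP; exists [:: (1, g)].
by rewrite big_seq1 mul1r; split=> // p; rewrite inE => /eqP->.
Qed.

Lemma ideal_span_ind (S : comNzRingType) (G : set S) (P : S -> Prop) :
  P 0 -> (forall x y, P x -> P y -> P (x + y)) ->
  (forall a g, G g -> P (a * g)) ->
  forall x, x \in ideal_span G -> P x.
Proof.
move=> P0 PD PG x /asboolP[r [rG ->]]; elim: r rG => [|p r IHr] rG.
  by rewrite big_nil.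
rewrite big_cons; apply: PD; first by apply: PG; apply: rG; rewrite mem_head.
by apply: IHr => q qr; apply: rG; rewrite in_cons qr orbT.
Qed.

Section TangentCone.
Variables (K : fieldType) (m : nat) (b : 'I_m -> nat).
Local Notation S := {mpoly K[m]}.

Definition initial_ideal : {pred S} :=
  ideal_span
    (fun g => exists f, [/\ f != 0, toric_ideal b f & g = initial_form f]).

Lemma initial_ideal_mul a g : g \in initial_ideal -> a * g \in initial_ideal.
Proof. exact: ideal_spanM. Qed.

(** Either the component is 0 or e is the initial degree. In this form later arguments need not
    track which components vanish. *)
Lemma pihomog_initial_ideal e (g : S) :
  order_ge e g -> toric_map b g = 0 -> pihomog mdeg e g \in initial_ideal.
Proof.
move=> ge_g g0; have [->|ge0] := eqVneq (pihomog mdeg e g) 0.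
  exact: ideal_span0.
apply: ideal_span_mem; exists g; split=> //.
  by apply: contraNneq ge0 => ->; rewrite pihomog0.
by rewrite /initial_form (initial_degree_eq ge_g ge0).
Qed.

Definition tangent_cone_pi (f : S^o) : tangent_cone K b := iq_pi _ f.

Lemma tangent_cone_pi_linear : linear tangent_cone_pi.
Proof. by move=> x f g; rewrite /tangent_cone_pi iq_piD -iq_pi_scale. Qed.

HB.instance Definition _ :=
  GRing.isLinear.Build S S^o (tangent_cone K b) *:%R
    tangent_cone_pi tangent_cone_pi_linear.

Lemma tangent_cone_pi_surj y : exists f, tangent_cone_pi f = y.
Proof. by exists (iq_repr y); apply: iq_reprK. Qed.

Lemma tangent_cone_pi_eq0 f : tangent_cone_pi f = 0 <-> f \in initial_ideal.
Proof.
rewrite -(linear0 tangent_cone_pi) -[f in X in _ <-> X]subr0.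
by split=> /iq_piP.
Qed.

End TangentCone.

(** * Total degree and coefficients in y *)

Section LastVariableDegree.
Variables (R : comNzRingType) (n : nat).
Local Notation S := {mpoly R[n]}.
Local Notation S' := {mpoly R[n.+1]}.

Lemma mdeg_mnmwiden (u : 'X_{1..n}) : mdeg (mnmwiden u) = mdeg u.
Proof.
rewrite !mdegE big_ord_recr /= mnmwiden_ordmax addn0.
by apply: eq_bigr => i _; rewrite mnmwiden_widen.
Qed.

Lemma pihomog_mwiden k (g : S) :
  pihomog mdeg k (mwiden g) = mwiden (pihomog mdeg k g).
Proof.
have [E E'] : g = \sum_(u <- msupp g) g@_u *: 'X_[u] /\
    pihomog mdeg k g = \sum_(u <- msupp g | mdeg u == k) g@_u *: 'X_[u].
  by split; rewrite ?pihomogE // -mpolyE.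
rewrite E' {1}E !(raddf_sum (@mwiden n R)) (raddf_sum (pihomog mdeg k)).
rewrite [RHS]big_mkcond /=; apply: eq_bigr => u _.
rewrite mwidenZ linearZ /= mwidenX pihomogX /= mdeg_mnmwiden.
by case: ifP; rewrite ?scaler0.
Qed.

Lemma mnm_lastP (u : 'X_{1..n.+1}) :
  exists v, u = (mnmwiden v + U_(ord_max) *+ u ord_max)%MM.
Proof.
exists [multinom u (widen_ord (leqnSn n) i) | i < n]; apply/mnmP => i.
rewrite mnmDE mulmnE mnm1E; have [j ->|->] := unliftP ord_max i; last first.
  by rewrite mnmwiden_ordmax eqxx mul1n.
rewrite (_ : lift _ j = widen_ord (leqnSn n) j); last exact/val_inj/lift_max.
rewrite mnmwiden_widen mnmE -val_eqE /=.
by rewrite (gtn_eqF (ltn_ord j)) mul0n addn0.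
Qed.

Lemma mdeg_mnm_last (v : 'X_{1..n}) j :
  mdeg (mnmwiden v + U_(ord_max) *+ j)%MM = (mdeg v + j)%N.
Proof. by rewrite mdegD mdeg_mnmwiden mdegMn mdeg1 mul1n. Qed.

Lemma order_ge_mwiden e (g : S) : order_ge e g -> order_ge e (mwiden g).
Proof.
move=> ge_g u lt_u; have := mcoeff_pihomog (mdeg u) (mwiden g) u.
rewrite eqxx => <-; rewrite pihomog_mwiden (order_ge_pihomog ge_g) //.
by rewrite mwiden0 mcoeff0.
Qed.

End LastVariableDegree.

(** * The initial ideal of the gluing *)

Section GluingTangentCone.
Variables (K : fieldType) (n : nat) (a : 'I_n -> nat) (c d : nat).
Local Notation S := {mpoly K[n]}.
Local Notation S' := {mpoly K[n.+1]}.
Local Notation aH := (gluing a c d).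
Local Notation IL := (initial_ideal (K := K) a).
Local Notation IH := (initial_ideal (K := K) aH).

Lemma ycoef_pihomog j k (g : S') :
  ycoef j (pihomog mdeg (k + j) g) = pihomog mdeg k (ycoef j g).
Proof.
apply/mpolyP => u; rewrite mcoeff_coef_muni !mcoeff_pihomog mcoeff_coef_muni.
by rewrite mdeg_mnm_last eqn_add2r.
Qed.

Lemma ycoef_pihomog_gt j k (g : S') : (k < j)%N ->
  ycoef j (pihomog mdeg k g) = 0.
Proof.
move=> lt_kj; apply/mpolyP => u; rewrite mcoeff_coef_muni mcoeff_pihomog.
by rewrite mdeg_mnm_last mcoeff0 (gtn_eqF (ltn_addl _ lt_kj)).
Qed.

(** The factor y^j supplies j of the required degree; for j at least e nothing remains to require,
    which truncated subtraction expresses. *)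
Lemma order_ge_ycoef e (g : S') :
  order_ge e g <-> forall j, order_ge (e - j) (ycoef j g).
Proof.
split=> ge_g => [j u lt_u|u lt_u].
  by rewrite mcoeff_coef_muni ge_g // mdeg_mnm_last addnC -ltn_subRL.
have [v def_u] := mnm_lastP u; rewrite def_u -mcoeff_coef_muni ge_g //.
by rewrite ltn_subRL addnC -mdeg_mnm_last -def_u.
Qed.

Lemma ycoef_ideal (G : set S) (p g : S') :
  (forall j, ycoef j g \in ideal_span G) ->
  forall j, ycoef j (p * g) \in ideal_span G.
Proof.
move=> gI j; rewrite /ycoef rmorphM coefM rpred_sum // => i _.
by apply: ideal_spanM; apply: gI.
Qed.

Hypotheses (c_gt0 : (0 < c)%N) (coprime_cd : coprime c d).
Variable w : S.
Hypotheses (toric_w : toric_map a w = 'X^d) (ge_w : order_ge c w).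
Let f : S' := 'X_ord_max ^+ c - mwiden w.
(** If the order of w exceeds c, this is 0 and f' is y^c; in any case f' is monic in y without
    constant term. *)
Let w' : S := pihomog mdeg c w.
Let f' : S' := 'X_ord_max ^+ c - mwiden w'.

Lemma order_ge_f : order_ge c f.
Proof.
apply: order_geB; last exact: order_ge_mwiden.
rewrite -{1}[c]muln1; apply: order_geX => u.
by rewrite ltnS leqn0 mdeg_eq0 mcoeffX => /eqP ->; rewrite mnm1_eq0.
Qed.

Lemma pihomog_f : pihomog mdeg c f = f'.
Proof.
rewrite linearB /= pihomog_mwiden; congr (_ - _).
by rewrite mpolyXn pihomogX /= mdegMn mdeg1 mul1n eqxx.
Qed.

(* This is where the order of w being at least c is essential: trading y^c for
   w never lowers the order. *)
Lemma order_ge_quotient e g :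
  order_ge e g -> order_ge (e - c) (quotient_f c w g).
Proof.
move=> /order_ge_ycoef ge_g; apply/order_ge_ycoef => j; rewrite ycoef_quotient.
apply: order_ge_sum => s _.
(* The order s c of [w ^+ s] compensates for the drop to e - (j + (s+1) c), leaving at least e - c -
   j. *)
have := order_geM (order_geX (k := s) ge_w) (ge_g (j + s.+1 * c)%N).
by apply: order_ge_leq; rewrite mulSn; lia.
Qed.

Lemma mwiden_initial_ideal h : h \in IL -> mwiden h \in IH.
Proof.
apply: (ideal_span_ind (P := fun h => mwiden h \in IH)).
- by rewrite mwiden0; apply: ideal_span0.
- by move=> x y xI yI; rewrite mwidenD rpredD.
move=> p _ [g [g0 gI ->]]; rewrite mwidenM; apply: initial_ideal_mul.
rewrite -pihomog_mwiden; apply: pihomog_initial_ideal.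
  exact/order_ge_mwiden/order_ge_initial_degree.
by rewrite toric_gluing_mwiden gI comp_poly0.
Qed.

(** Takes the component of degree e in g = f q + r. That of f q is a multiple of f'; that of r has
    as y-coefficients components of elements of the toric ideal of L. *)
Lemma initial_form_gluing e g : order_ge e g -> toric_map aH g = 0 ->
  exists q, forall j, ycoef j (pihomog mdeg e g - f' * q) \in IL.
Proof.
move=> ge_g g0; set q := quotient_f c w g; set r := g - f * q.
have ge_q : order_ge (e - c) q by apply: order_ge_quotient.
have ge_fq := order_geM order_ge_f ge_q.
have [q' fq'] : exists q', pihomog mdeg e (f * q) = f' * q'.
  have [le_ce|lt_ec] := leqP c e.
    exists (pihomog mdeg (e - c) q).
    by rewrite -[in LHS](subnKC le_ce) (pihomogM order_ge_f ge_q) pihomog_f.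
  (* For e < c the product f q, of order at least c, has no component in degree e. *)
  exists 0; rewrite mulr0 (order_ge_pihomog ge_fq) //.
  by rewrite (leq_trans lt_ec) ?leq_addr.
have ge_r : order_ge e r.
  apply: order_geB => //; apply: order_ge_leq ge_fq.
  by rewrite -leq_subLR.
have r_toric : forall j, toric_map a (ycoef j r) = 0.
  apply: (toric_gluing_inj c_gt0 coprime_cd).
    by move=> j; apply: ycoef_remainder.
  by rewrite rmorphB rmorphM /= g0 (toric_gluing_f c toric_w) mul0r subrr.
exists q' => j; rewrite -fq' -linearB /= -/r.
have [le_je|lt_ej] := leqP j e; last first.
  by rewrite ycoef_pihomog_gt //; apply: ideal_span0.
rewrite -(subnK le_je) ycoef_pihomog; apply: pihomog_initial_ideal => //.
by move/order_ge_ycoef: ge_r; apply.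
Qed.

Lemma initial_ideal_gluing g :
  g \in IH <-> exists q, forall j, ycoef j (g - f' * q) \in IL.
Proof.
split=> [|[q qP]].
  apply: (ideal_span_ind
    (P := fun g => exists q, forall j, ycoef j (g - f' * q) \in IL)).
  - by exists 0 => j; rewrite mulr0 subrr raddf0; apply: ideal_span0.
  - move=> x y [q1 P1] [q2 P2]; exists (q1 + q2) => j.
    rewrite mulrDr opprD addrACA (raddfD (ycoef j)).
    by apply: rpredD; [apply: P1|apply: P2].
  - move=> p _ [h [_ hI ->]].
    have [q qP] := initial_form_gluing (@order_ge_initial_degree _ _ h) hI.
    exists (p * q) => j; rewrite mulrCA -mulrBr.
    exact: ycoef_ideal.
rewrite -(subrK (f' * q) g) rpredD //.
  rewrite [_ - _]muni_sum rpred_sum // => j _; rewrite mulrC.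
  by apply: initial_ideal_mul; apply: mwiden_initial_ideal; apply: qP.
rewrite mulrC initial_ideal_mul // -pihomog_f.
apply: pihomog_initial_ideal; first exact: order_ge_f.
exact: toric_gluing_f.
Qed.

Lemma betti_tangent_cone_gluing i :
  betti_tangent_cone K aH i.+1 =
  (betti_tangent_cone K a i.+1 + betti_tangent_cone K a i)%N.
Proof.
have w'0 : w'@_0%MM = 0.
  by rewrite mcoeff_pihomog mdeg0; case: eqP => // c0; move: c_gt0; rewrite -c0.
apply: (@betti_gluing K n c w' c_gt0 w'0 (tangent_cone K a)
          (tangent_cone K aH) (tangent_cone_pi a) (tangent_cone_pi aH)).
- exact: tangent_cone_pi_surj.
- exact: tangent_cone_pi_surj.
move=> g /=; rewrite tangent_cone_pi_eq0 initial_ideal_gluing.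
by split=> -[q qP]; exists q => j; apply/tangent_cone_pi_eq0.
Qed.

End GluingTangentCone.

(** * Choice of the monomial w *)

Lemma sgp_ord_attained (n : nat) (a : 'I_n -> nat) (c d : nat) :
  (0 < c <= sgp_ord a d)%N ->
  exists2 l : 'I_n -> nat, (\sum_i a i * l i = d)%N & (c <= \sum_i l i)%N.
Proof.
(* If all representations of d have coefficient sum below c, so does the maximum; positivity of c
   covers the empty maximum, which is 0. *)
case/andP=> c_gt0; apply: contraPP => no_l; apply/negP; rewrite -ltnNge.
rewrite -[c in (_ < c)%N](prednK c_gt0) ltnS; apply/bigmax_leqP => l /eqP def_d.
rewrite -ltnS prednK // ltnNge; apply/negP => le_c; apply: no_l.
exists (fun i => nat_of_ord (l i)) => //; rewrite -[RHS]def_d.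
by apply: eq_bigr => i _; rewrite mulnC.
Qed.

Theorem theorem5p2 (K : fieldType) (n : nat) (a : 'I_n -> nat) (L : set nat)
    (c d : nat) (hL : numerical_semigroup L) (ha : minimally_generates a L)
    (ha_lt : forall i j : 'I_n, (i < j)%N -> (a i < a j)%N)
    (hc : (1 < c)%N) (hcd : coprime c d)
    (hdL : L d) (hda : forall i : 'I_n, d <> a i) :
  let aH := gluing a c d in
  (forall i : nat, (0 < i)%N ->
     betti_semigroup_ring K aH i =
     (betti_semigroup_ring K a i + betti_semigroup_ring K a i.-1)%N) /\
  ((c <= sgp_ord a d)%N ->
   forall i : nat, (0 < i)%N ->
     betti_tangent_cone K aH i =
     (betti_tangent_cone K a i + betti_tangent_cone K a i.-1)%N).
Proof.
have c_gt0 : (0 < c)%N by apply: ltnW.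
split=> [|le_c] [|i] // _.
  move: hdL; case: ha => -> _ [l def_d].
  pose u := [multinom l i | i < n].
  have def_d' : (\sum_i a i * u i = d)%N.
    rewrite def_d; apply: eq_big => [j|j _]; first by rewrite inE.
    by rewrite mnmE mulnC.
  apply: (@betti_semigroup_ring_gluing K n a c d c_gt0 hcd 'X_[u]).
    by rewrite toric_mapX def_d'.
  (* A constant monomial would mean d = 0, and then coprimality forces c = 1. *)
  rewrite mcoeffX; case: eqP => // u0; move: hcd hc.
  rewrite -def_d' u0 big1 => [|j _]; last by rewrite mnm0E muln0.
  by rewrite /coprime gcdn0 => /eqP->.
(* A representation of d with coefficient sum at least c gives a monomial w of order at least c. *)
have [|l def_d le_l] := @sgp_ord_attained n a c d; first by rewrite c_gt0.
apply: (@betti_tangent_cone_gluing K n a c d c_gt0 hcd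
          'X_[[multinom l i | i < n]]).
  rewrite toric_mapX -def_d; congr 'X^_.
  by apply: eq_bigr => j _; rewrite mnmE.
move=> v lt_v; rewrite mcoeffX; case: eqP => // def_v; move: lt_v.
rewrite -def_v mdegE ltnNge (eq_bigr l) ?le_l // => j _.
by rewrite mnmE.
Qed.
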